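(* Let $\Omega$ be any infinite set, let $\mathcal{P}=\{\Sigma_0,\Sigma_1,\ldots,\Sigma_{n-1}\}$, $n\geq 2$, be a finite partition of $\Omega$, and let $f,g\in\Omega^\Omega$. Then the following are equivalent: (I) $\langle\operatorname{Stab}(\mathcal{P}),f,g\rangle=\Omega^\Omega$; (II) $\langle\operatorname{AStab}(\mathcal{P}),f,g\rangle=\Omega^\Omega$; (III) up to renaming $f$ and $g$: $f$ is injective, $d(f)=|\Omega|$, $g$ is surjective, and either $|\Omega|$ is regular and $k(g,|\Omega|)=|\Omega|$, or $|\Omega|$ is singular and $k(g,\nu)=|\Omega|$ for all cardinals $\nu<|\Omega|$; and one of the following holds: (i) $\rho_f,\rho_g\notin\operatorname{Sym}(n)$; (ii) $\rho_f\notin\operatorname{Sym}(n)$ and $\rho_f^{-1}$ is total; (iii) $\rho_g\notin\operatorname{Sym}(n)$ and $\rho_g$ is total.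
   Context: $\Omega^\Omega$ is the semigroup of all mappings from $\Omega$ to itself (written to the right of their arguments and composed from left to right), and $\operatorname{Sym}(\Omega)$ is the symmetric group on $\Omega$. $\langle\,\cdot\,\rangle$ denotes the subsemigroup generated. For $f\in\Omega^\Omega$, $d(f)=|\Omega\setminus\Omega f|$; for a cardinal $\mu\leq|\Omega|$, $k(f,\mu)=|\{\alpha\in\Omega:|\alpha f^{-1}|\geq\mu\}|$, where $\alpha f^{-1}=\{\beta\in\Omega:\beta f=\alpha\}$. A finite partition of $\Omega$ is a partition $\{\Sigma_0,\ldots,\Sigma_{n-1}\}$ of $\Omega$ into $n\geq2$ parts with $|\Sigma_0|=\cdots=|\Sigma_{n-1}|=|\Omega|$. $\operatorname{Stab}(\mathcal{P})=\{f\in\operatorname{Sym}(\Omega):(\forall i)(\exists j)(\Sigma_i f=\Sigma_j)\}$ and $\operatorname{AStab}(\mathcal{P})=\{f\in\operatorname{Sym}(\Omega):(\forall i)(\exists j)(|\Sigma_i f\setminus\Sigma_j|+|\Sigma_j\setminus\Sigma_i f|<|\Omega|)\}$. For $f\in\Omega^\Omega$, $\rho_f=\{(i,j):|\Sigma_i f\cap\Sigma_j|=|\Omega|\}$, a binary relation on $\{0,\ldots,n-1\}$. For a binary relation $\sigma$, $\sigma^{-1}=\{(i,j):(j,i)\in\sigma\}$; $\sigma$ is total if for every $i$ there is $j$ with $(i,j)\in\sigma$. $\operatorname{Sym}(n)$ is the symmetric group on $\{0,\ldots,n-1\}$, its elements being regarded as binary relations. The phrase ''up to renaming $f$ and $g$''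 applies to the whole of (III), with the same naming throughout. *)

(* Defs.v *)
From mathcomp Require Import all_boot perm.
From mathcomp Require Export boolp classical_sets functions cardinality.

Set Implicit Arguments.
Unset Strict Implicit.
Unset Printing Implicit Defensive.

Local Open Scope classical_set_scope.
Local Open Scope card_scope.

Definition card_lt (T U : Type) (A : set T) (B : set U) : Prop :=
  A #<= B /\ ~ (B #<= A).

Notation "A '#<' B" := (card_lt A B)
  (at level 79, format "A  '#<'  B") : card_scope.

(* A copy of A and a copy of B side by side, so that the cardinal of
   [disjoint_sum A B] is |A| + |B| *)
Definition disjoint_sum (T U : Type) (A : set T) (B : set U) : set (T + U) :=
  (inl @` A) `|` (inr @` B).

Section Transformations.
Variable Omega : Type.
Implicit Types (f g : Omega -> Omega) (S : set (Omega -> Omega)).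

(* Maps are written on the right, so the product f g is [g \o f]. *)
Definition mul_closed S : Prop := forall f g, S f -> S g -> S (g \o f).

Definition generated S : set (Omega -> Omega) := smallest mul_closed S.

Definition Sym : set (Omega -> Omega) := [set f | bijective f].

(* The complement whose cardinal is d(f) *)
Definition defect_set f : set Omega := ~` range f.

(* The set whose cardinal is k(f, |N|). Every cardinal at most |Omega| is that
   of a subset of Omega, so N ranges over subsets of Omega. *)
Definition contraction_set f (N : set Omega) : set Omega :=
  [set a | N #<= f @^-1` [set a]].

(* Omega is not a union of fewer than |Omega| sets, each smaller than Omega.
   The index set I has fewer than |Omega| elements, hence can be taken inside
   Omega. For infinite Omega, |Omega| is singular iff it is not regular. *)
Definition regular_card : Prop :=
  forall (I : set Omega) (F : Omega -> set Omega),
    I #< [set: Omega] -> (forall i, I i -> F i #< [set: Omega]) ->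
    \bigcup_(i in I) F i <> [set: Omega].

Definition singular_card : Prop :=
  infinite_set [set: Omega] /\ ~ regular_card.

Section Partition.
Variables (n : nat) (P : 'I_n -> set Omega).

Definition finite_partition : Prop :=
  [/\ (1 < n)%N,
      partition [set: 'I_n] P [set: Omega] &
      forall i, P i #= [set: Omega]].

Definition Stab : set (Omega -> Omega) :=
  [set f | Sym f /\ forall i, exists j, f @` P i = P j].

Definition AStab : set (Omega -> Omega) :=
  [set f | Sym f /\ forall i, exists j,
    disjoint_sum (f @` P i `\` P j) (P j `\` f @` P i) #< [set: Omega]].

Definition rho f : set ('I_n * 'I_n) :=
  [set ij | (f @` P ij.1 `&` P ij.2) #= [set: Omega]].

End Partition.
End Transformations.

Definition relation_of_perm (n : nat) (s : 'S_n) : set ('I_n * 'I_n) :=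
  [set ij | s ij.1 = ij.2].

(* The symmetric group on {0, ..., n-1} as a set of binary relations *)
Definition SymRel (n : nat) : set (set ('I_n * 'I_n)) :=
  range (@relation_of_perm n).

Definition total_relation (n : nat) (r : set ('I_n * 'I_n)) : Prop :=
  forall i, exists j, r (i, j).

(* f and g are not interchangeable here: f is the injective map. *)
Definition generating_condition (Omega : Type) (n : nat) (P : 'I_n -> set Omega)
    (f g : Omega -> Omega) : Prop :=
  [/\ injective f,
      defect_set f #= [set: Omega],
      set_surj [set: Omega] [set: Omega] g,
      (regular_card Omega /\
         contraction_set g [set: Omega] #= [set: Omega]) \/
      (singular_card Omega /\
         forall N : set Omega, N #< [set: Omega] ->
           contraction_set g N #= [set: Omega]) &
      [\/ ~ SymRel (rho P f) /\ ~ SymRel (rho P g),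
          ~ SymRel (rho P f) /\ total_relation (rho P f)^-1%relation |
          ~ SymRel (rho P g) /\ total_relation (rho P g)]].

(* Main.v *)
Require Import Defs.
From HB Require Import structures.
From Stdlib Require Import Inverse_Image.
From mathcomp Require Import all_boot perm.
From mathcomp Require Import boolp classical_sets functions cardinality wochoice.

(** Maps act on the right: u v is first u, then v. A set is large when it is
equinumerous with Omega, and the blocks are the parts of the partition.

Necessity. Each clause of the condition is the failure of an obstruction, that
is, of a proper subsemigroup of the full transformation semigroup containing the
almost stabiliser and therefore unable to contain both f and g
([proper_subsemigroup]). The obstructions are: the maps that are bijective or not
injective; those that are bijective or not surjective; those whose defect is not
large; those with few large fibres, or, in the singular case, with few fibres of
at least some size below |Omega|; and the maps u whose relation rho(u) is a
permutation or is not total, and the same with the inverse of rho(u). The last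
two are closed under products because rho(u v) is contained in the product of
rho(u) and rho(v) ([rho_comp], [SymRel_comp]).

Sufficiency. Every map is a product F a H as soon as F is an injection missing a
large part of every block, H is a surjection whose fibres all meet every block in
a large set, and a ranges over the permutations that preserve every block: it
suffices to choose the a-image of t F, one t at a time, in the fibre of H over the
prescribed value and in the block of t F ([all_maps]). So F and H have to be
generated.

For F, multiply f by itself with permutations in between that move a missed part
of one block onto points whose images lie in a block not yet missed
([spread_injection]). The same argument applied to the sections of elements of
the semigroup turns g into a surjection G having a section that misses a large
part of every block ([spread_section]).

For H, the relations of f and g are used. With suitable permutations b in between,
rho(u b v) contains the product of rho(u), any permutation of the indices, and
rho(v) ([crosses_twisted]). A total relation outside Sym(n) has two rows sharing a
column, and this makes products grow until one column is full ([full_column]);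
dually, a relation with total inverse outside Sym(n) leads to a full row. Since
rho(f) and the inverse of rho(g) are always total, each of the three cases
provides both: some u sends a large part of every block into one block, and some r
sends large parts of one block into all the blocks. Then r b G maps a single
block onto Omega ([section_into_block]). On the other hand g, or g b g in the
singular case, has a large number of fibres that are large within one block; u
spreads these fibres over all the blocks, and a permutation followed by r b G
spreads their images over the whole of Omega, which gives H ([full_fibers]).

Two facts make all the choices of permutations possible: from a family of at most
|Omega| large sets distinct representatives can be chosen ([injective_choice]), and
a partial injection compatible with the blocks extends to a permutation as soon as
its domain and its range miss a large part of every block ([extend_permuting]). *)

Set Implicit Arguments.
Unset Strict Implicit.
Unset Printing Implicit Defensive.

(** * Products of relations on a finite set *)

(** By induction on the number of elements of J outside B: a transposition
exchanges one of them with an element of B outside J. *)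
Lemma perm_into (I : finType) (J B : {set I}) : (#|J| <= #|B|)%N ->
  exists pi : {perm I}, forall j, j \in J -> pi j \in B.
Proof.
move: J; suff H m : forall J : {set I}, (#|J :\: B| <= m)%N -> (#|J| <= #|B|)%N ->
    exists pi : {perm I}, forall j, j \in J -> pi j \in B.
  by move=> J; exact: (H #|J :\: B|).
elim: m => [|m IH] J.
  rewrite leqn0 cards_eq0 finset.setD_eq0 => /fintype.subsetP JB _.
  by exists 1%g => j /JB; rewrite perm1.
move=> Jm JB; have [JB0|/finset.set0Pn[j]] := eqVneq (J :\: B) finset.set0.
  by apply: IH; rewrite // JB0 cards0.
rewrite finset.inE => /andP[jB jJ].
have [b] : exists b, b \in B :\: J.
  apply/finset.set0Pn; rewrite -card_gt0.
  have JBgt0 : (0 < #|J :\: B|)%N.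
    by rewrite card_gt0; apply/finset.set0Pn; exists j; rewrite finset.inE jB.
  rewrite (leq_trans JBgt0)// -(leq_add2l #|J :&: B|) cardsID finset.setIC cardsID.
  by [].
rewrite finset.inE => /andP[bJ bB].
have bJj : b \notin J :\ j by rewrite finset.inE negb_and bJ orbT.
have [||pi piP] := IH (b |: J :\ j).
- rewrite -ltnS (leq_trans _ Jm)// [ltnRHS](cardsD1 j).
  rewrite finset.inE jB jJ add1n ltnS subset_leq_card//.
  apply/fintype.subsetP => x; rewrite !finset.inE => /andP[xB /orP[/eqP xb|/andP[-> ->]]].
    by rewrite xb bB in xB.
  by rewrite xB.
- by rewrite cardsU1 bJj; move: JB; rewrite [X in (X <= _)%N](cardsD1 j) jJ.
exists (tperm j b * pi)%g => x xJ; rewrite permM; apply: piP; rewrite !finset.inE.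
have [<-|jx] := eqVneq j x; first by rewrite tpermL eqxx.
have bx : b != x by apply: contraNneq bJ => ->.
by rewrite tpermD// [x == j]eq_sym jx xJ orbT.
Qed.

Section Relations.
Variable n : nat.
Implicit Types (r s : 'I_n -> 'I_n -> Prop) (C : ('I_n -> 'I_n -> Prop) -> Prop).

(** The family of relations contained in some rho(u), for u in a semigroup containing
the stabiliser of the partition, has this property: the permutation pi of the
indices comes from a block permutation inserted between two maps. *)
Definition twisted_closed C := forall r s (pi : {perm 'I_n}), C r -> C s ->
  exists2 v, C v & forall i j k, r i j -> s (pi j) k -> v i k.

(** Let J be a set of columns of r met by more than |J| rows. If at least |J| rows of a
product v meet column k, permute the indices so that J is sent among these rows:
then more than |J| rows of the product of r, this permutation and v meet column k.
Hence the number of rows meeting one column can be increased until it is n. *)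
Lemma full_column C r i1 i2 j0 : twisted_closed C -> C r ->
  (forall i, exists j, r i j) -> i1 != i2 -> r i1 j0 -> r i2 j0 ->
  exists2 v, C v & exists k, forall i, v i k.
Proof.
move=> Ccl Cr rtot i12 r1 r2.
pose pre (J : {set 'I_n}) := [set i | [exists j in J, `[< r i j >]]].
have preP (J : {set 'I_n}) i : reflect (exists2 j, j \in J & r i j) (i \in pre J).
  rewrite finset.inE; apply: (iffP existsP) => [[j /andP[jJ /asboolP rij]]|[j jJ rij]];
    exists j => //.
  by rewrite jJ; exact/asboolP.
(* The shared column j0 gives a surplus of one row over the columns, and adding a
   column that meets a row not yet covered preserves this surplus. *)
have grow m : (0 < m < n)%N -> exists J : {set 'I_n}, (#|J| <= m)%N /\ (m < #|pre J|)%N.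
  elim: m => // m IH /andP[_ mn]; have [m0|m0] := posnP m.
    exists [set j0]; rewrite cards1 m0; split=> //.
    rewrite (leq_trans _ (subset_leq_card (_ : [set i1; i2] \subset _)))//.
      by rewrite cards2 i12.
    by apply/fintype.subsetP => i /finset.set2P[->|->]; apply/preP;
      exists j0; rewrite ?finset.set11.
  have [|J [Jm preJ]] := IH; first by rewrite m0 ltnW.
  have [preT|] := eqVneq (pre J) [set: 'I_n].
    by exists J; rewrite preT cardsT card_ord; split=> //; exact: leqW.
  rewrite -finset.subTset => /fintype.subsetPn[i _ Ni].
  have [j rij] := rtot i; exists (j |: J).
  split; first by rewrite cardsU1; case: (_ \notin _) => //=; rewrite ?add1n ?add0n // leqW.
  apply: (leq_trans (_ : _ <= #|i |: pre J|)%N); first by rewrite cardsU1 Ni.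
  apply/subset_leq_card/fintype.subsetP => i' /finset.setU1P[->|/preP[j' Jj' rij']].
    by apply/preP; exists j; rewrite ?finset.setU11.
  by apply/preP; exists j' => //; exact: finset.setU1r.
suff /(_ n (leqnn n))[v Cv [k vk]] m : (m <= n)%N -> exists2 v, C v &
    exists k, (m <= #|[set i | `[< v i k >]]|)%N.
  exists v => //; exists k => i.
  have /eqP/finset.setP/(_ i) : [set i | `[< v i k >]] == [set: 'I_n].
    by rewrite eqEcard finset.subsetT cardsT card_ord.
  by rewrite !finset.inE => /asboolP.
elim: m => [|m IH] mn; first by exists r => //; exists j0.
have [|v Cv [k vk]] := IH; first exact: ltnW.
have [m0|m0] := posnP m.
  exists r => //; exists j0; rewrite m0 card_gt0; apply/finset.set0Pn; exists i1.
  by rewrite finset.inE; exact/asboolP.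
have [|J [Jm preJ]] := grow m; first by rewrite m0.
have [pi piP] := perm_into (leq_trans Jm vk).
have [u Cu uP] := Ccl r v pi Cr Cv; exists u => //; exists k.
apply: leq_trans preJ _; apply/subset_leq_card/fintype.subsetP => i /preP[j Jj rij].
rewrite finset.inE; apply/asboolP; apply: uP rij _.
by have := piP _ Jj; rewrite finset.inE => /asboolP.
Qed.

End Relations.


Local Open Scope classical_set_scope.
Local Open Scope card_scope.

(** If no column is shared, choosing an entry in each row is an injection of the finite
index set, hence a permutation, and leaves room for no other entry. *)
Lemma shared_column n (r : set ('I_n * 'I_n)) : total_relation r -> ~ SymRel r ->
  exists i1 i2 j, [/\ i1 != i2, r (i1, j) & r (i2, j)].
Proof.
move=> /choice[s rs] Nsym; apply: contrapT => N; apply: Nsym.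
have rI i i' j : r (i, j) -> r (i', j) -> i = i'.
  move=> rij rij'; apply: contrapT => /eqP ii'; apply: N.
  by exists i, i', j.
have sI : injective s by move=> i i' e; apply: (rI _ _ (s i)) => //; rewrite e.
exists (perm sI) => //; apply/seteqP; split=> -[i j]; rewrite /relation_of_perm /= permE.
  by move=> <-.
move=> rij; have /codomP[i' ji'] : j \in codom s.
  by rewrite (inj_card_onto sI).
by rewrite ji' in rij *; rewrite (rI _ _ _ rij (rs i')).
Qed.

Lemma SymRel_inv n (r : set ('I_n * 'I_n)) : SymRel r^-1%relation <-> SymRel r.
Proof.
suff H (q : set ('I_n * 'I_n)) : SymRel q -> SymRel q^-1%relation.
  split=> [/H|]; last exact: H.
  by suff -> : (r^-1)^-1%relation = r by []; apply/seteqP; split=> -[].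
move=> [s _ <-]; exists (s^-1)%g => //.
apply/seteqP; split=> -[i j]; rewrite /relation_of_perm /=.
  by move=> <-; rewrite permKV.
by move=> <-; rewrite permK.
Qed.

(** * Cardinal arithmetic *)

(** Functions defined on the ambient types are easier to combine than the injections
between subtypes in the definition of [#<=]; the point u is the value taken
outside A. *)
Lemma card_leEx (T U : Type) (u : U) (A : set T) (B : set U) :
  A #<= B <-> exists f : T -> U, (forall x, A x -> B (f x)) /\
    (forall x y, A x -> A y -> f x = f y -> x = y).
Proof.
split=> [/card_leP[f]|[f [fAB fI]]].
  exists (fun x => if pselect (A x) is left Ax then val (f (SigSub (mem_set Ax)))
                   else u); split=> [x Ax|x y Ax Ay].
    by case: pselect => // Ax'; exact: set_valP.
  case: pselect => // Ax'; case: pselect => // Ay' /val_inj.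
  have fI : {in [set: A] &, injective f} by exact: inj.
  by move/fI; rewrite !inE => /(_ I I) [].
have fun_ : {homo f : x / A x >-> B x} by [].
have finj : {in A &, injective f} by move=> x y /set_mem Ax /set_mem Ay; exact: fI.
have [g _] := Pfun fun_.
apply/card_leP/injfunPex.
exists (fun x : A => SigSub (mem_set (fAB _ (set_valP x)))) => //.
move=> x y _ _ /(congr1 val)/= /fI e; apply: val_inj; apply: e; exact: set_valP.
Qed.

(** Zorn's lemma for graphs of partial injections: a maximal one is defined on all of A
or covers B. *)
Lemma card_le_total (T U : Type) (A : set T) (B : set U) : A #<= B \/ B #<= A.
Proof.
pose P := [set R : set (T * U) |
  (forall r, R r -> A r.1 /\ B r.2) /\
  (forall r s, R r -> R s -> r.1 = s.1 <-> r.2 = s.2)].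
have [F FP Ftot|R [[RAB RI] Rmax]] := @Zorn_bigcup _ P.
  split=> [r [R FR Rr]|r s [R FR Rr] [S FS Ss]]; first exact: (FP _ FR).1.
  by case: (Ftot _ _ FR FS) => sub; [apply: (FP _ FS).2|apply: (FP _ FR).2] => //;
    exact: sub.
have [domR|/existsNP[a /not_implyP[Aa Na]]] :=
  pselect (forall x, A x -> exists y, R (x, y)).
  left; have [->|/set0P[a /domR[u _]]] := eqVneq A set0; first exact: card_ge0.
  have /choice[f fR] : forall x, exists y, A x -> R (x, y).
    move=> x; have [/domR[y]|Nx] := pselect (A x); last by exists u.
    by exists y.
  apply/(card_leEx u); exists f; split=> [x /fR/RAB[]//|x y /fR Rx /fR Ry e].
  exact: (RI _ _ Rx Ry).2 e.
have [ranR|/existsNP[b /not_implyP[Bb Nb]]] :=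
  pselect (forall y, B y -> exists x, R (x, y)).
  right; have /choice[f fR] : forall y, exists x, B y -> R (x, y).
    move=> y; have [/ranR[x]|Nx] := pselect (B y); last by exists a.
    by exists x.
  apply/(card_leEx a); exists f; split=> [x /fR/RAB[]//|x y /fR Rx /fR Ry e].
  exact: (RI _ _ Rx Ry).1 e.
case: (Rmax (R `|` [set (a, b)])).
  split; first exact: subsetUl.
  by move=> sub; apply: Na; exists b; apply: sub; right.
split=> [r [/RAB//|->//]|r s [Rr|->] [Rs|->] //=]; first exact: RI.
- split=> e; first by case: Na; exists r.2; rewrite -e; case: r Rr {e}.
  by case: Nb; exists r.1; rewrite -e; case: r Rr {e}.
- split=> e; first by case: Na; exists s.2; rewrite e; case: s Rs {e}.
  by case: Nb; exists s.1; rewrite e; case: s Rs {e}.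
Qed.

Definition pairing_on (T : Type) (A : set T) (p : T -> T -> T) :=
  (forall x y, A x -> A y -> A (p x y)) /\
  (forall x y x' y', A x -> A y -> A x' -> A y' -> p x y = p x' y' ->
     x = x' /\ y = y').

(** Zorn's lemma for pairings defined on subsets of T, ordered by extension. The initial
one lives on a countable subset; keeping two of its points a0 and a1 in all the
domains ensures that a maximal domain can code a binary choice. *)
Lemma maximal_pairing (T : Type) : infinite_set [set: T] ->
  exists A (p : T -> T -> T) a0 a1,
    [/\ pairing_on A p, A a0, A a1, a0 <> a1 &
        forall B q, pairing_on B q -> A `<=` B ->
          (forall x y, A x -> A y -> q x y = p x y) -> B `<=` A].
Proof.
move=> /infiniteP Tinf.
have [t0 _] : exists t : T, True.
  by have /card_leP[f] := Tinf; exists (val (f (SigSub (mem_set (I : setT 0))))).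
have /(card_leEx t0)[e [_ eI]] := Tinf.
have {}eI : injective e by move=> x y; exact: eI.
pose D := {d : set T * (T -> T -> T) | [/\ pairing_on d.1 d.2, d.1 (e 0) & d.1 (e 1)]}.
pose R := fun d d' : D => `[< (sval d).1 `<=` (sval d').1 /\
  forall x y, (sval d).1 x -> (sval d).1 y -> (sval d').2 x y = (sval d).2 x y >].
have [d0 _] : exists d : D, True.
  have /choice[k kE] : forall x, exists i, range e x -> x = e i.
    move=> x; have [[i _ <-]|Nx] := pselect (range e x); last by exists 0.
    by exists i.
  have keE i : k (e i) = i by apply: eI; rewrite -kE//; exists i.
  pose p x y := e (pickle (k x, k y)).
  suff dP : [/\ pairing_on (range e) p, range e (e 0) & range e (e 1)].
    by exists (exist _ (range e, p) dP).
  split; [|by exists 0|by exists 1].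
  split=> [x y _ _|_ _ _ _ [i _ <-] [j _ <-] [i' _ <-] [j' _ <-]].
      by exists (pickle (k x, k y)).
  rewrite /p !keE => /eI/(congr1 (@unpickle (nat * nat)%type)).
  by rewrite !pickleK => -[-> ->].
have [d| | |d dmax] := ZL_preorder d0 (R := R).
- by apply/asboolP; split.
- move=> d1 d2 d3 /asboolP[s12 e12] /asboolP[s23 e23]; apply/asboolP; split.
    exact: subset_trans s23.
  by move=> x y xd yd; rewrite e23 ?e12//; exact: s12.
- move=> C Ctot; have [[c0 Cc0]|C0] := pselect (exists c, C c); last first.
    by exists d0 => s Cs; case: C0; exists s.
  pose A := \bigcup_(c in C) (sval c).1.
  have both x y : A x -> A y -> exists c, [/\ C c, (sval c).1 x & (sval c).1 y].
    move=> [c Cc cx] [c' Cc' cy]; case: (Ctot _ _ Cc Cc') => /asboolP[s _].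
      by exists c'; split=> //; exact: s.
    by exists c; split=> //; exact: s.
  have /choice[p0 p0E] : forall xy : T * T, exists z, forall c, C c ->
      (sval c).1 xy.1 -> (sval c).1 xy.2 -> z = (sval c).2 xy.1 xy.2.
    move=> [x y]; have [[c [Cc cx cy]]|Nc] :=
      pselect (exists c, [/\ C c, (sval c).1 x & (sval c).1 y]); last first.
      by exists t0 => c Cc cx cy; case: Nc; exists c.
    exists ((sval c).2 x y) => c' Cc' c'x c'y /=.
    by case: (Ctot _ _ Cc Cc') => /asboolP[s ->].
  have pE c : C c -> forall x y, (sval c).1 x -> (sval c).1 y ->
      p0 (x, y) = (sval c).2 x y.
    by move=> Cc x y cx cy; exact: (p0E (x, y)).
  have dA : [/\ pairing_on A (fun x y => p0 (x, y)), A (e 0) & A (e 1)].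
    split; last 2 first.
    - by exists c0 => //; case: (svalP c0).
    - by exists c0 => //; case: (svalP c0).
    split=> [x y /both/[apply] -[c [Cc cx cy]]|x y x' y' /both/[apply]].
      rewrite (pE c)//; exists c => //.
      by case: (svalP c) => -[pc _] _ _; exact: pc.
    move=> [c [Cc cx cy]] /both/[apply] -[c' [Cc' cx' cy']].
    have [c'' [Cc'' s s']] : exists c'', [/\ C c'', (sval c).1 `<=` (sval c'').1
        & (sval c').1 `<=` (sval c'').1].
      by case: (Ctot _ _ Cc Cc') => /asboolP[s _]; [exists c'|exists c]; split.
    have [[_ pI] _ _] := svalP c''.
    have [[[sx sy] sx'] sy'] := (s _ cx, s _ cy, s' _ cx', s' _ cy').
    by rewrite !(pE c'')// => /pI; exact.
  exists (exist _ (A, fun x y => p0 (x, y)) dA) => c Cc; apply/asboolP.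
  by split=> [x cx|x y cx cy] /=; [exists c|rewrite (pE c)].
case: d dmax => -[A p] dP dmax; have /= [pairA A0 A1] := dP.
exists A, p, (e 0), (e 1); split=> //; first by move/eI.
move=> B q pairB AB qp.
have Bq : [/\ pairing_on B q, B (e 0) & B (e 1)] by split=> //; exact: AB.
suff /asboolP[] : R (exist _ (B, q) Bq) (exist _ (A, p) dP) by [].
by apply: dmax; apply/asboolP; split.
Qed.

(** Let A be the domain of a maximal pairing p. If the complement of A embeds into A,
then so does T, coding by a0 or a1 whether a point comes from A. Otherwise the
complement contains a copy f(A) of A, in which the pairs from A and f(A) not both
in A can be encoded injectively, so that p extends to A together with f(A), against
maximality. *)
Lemma infinite_square (T : Type) : infinite_set [set: T] ->
  exists p : T * T -> T, injective p.
Proof.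
move=> /maximal_pairing[A [p [a0 [a1 [[pA pI] A0 A1 a01 Amax]]]]].
have a10 : a1 <> a0 by exact: nesym.
suff [r [rA rI]] : exists r : T -> T, (forall x, A (r x)) /\ injective r.
  exists (fun xy => p (r xy.1) (r xy.2)) => -[x y] [x' y'] /= /pI.
  by move=> /(_ (rA _) (rA _) (rA _) (rA _))[/rI -> /rI ->].
have [/(card_leEx a0)[f [fA fI]]|/(card_leEx a0)[f [fA fI]]] :=
  card_le_total (~` A) A.
  pose c x := if pselect (A x) is left _ then a0 else a1.
  pose r x := if pselect (A x) is left _ then x else f x.
  have cA x : A (c x) by rewrite /c; case: pselect.
  have rA x : A (r x) by rewrite /r; case: pselect => // Nx; exact: fA.
  exists (fun x => p (c x) (r x)); split=> [x|x y /pI]; first exact: pA.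
  move=> /(_ (cA _) (rA _) (cA _) (rA _))[]; rewrite /c /r.
  by case: pselect => Ax; case: pselect => Ay // _; exact: fI.
exfalso.
pose B := A `|` f @` A.
have fN x : A x -> ~ A (f x) by move=> /fA.
(* c remembers the side on which a point of B lies, and r brings it back to A *)
have /choice[r rE] : forall x, exists y, B x -> A y /\ (~ A x -> f y = x) /\ (A x -> y = x).
  move=> x; have [Ax|Nx] := pselect (A x); first by exists x => _; split; last split.
  have [[y Ay fy]|Nx'] := pselect ((f @` A) x); first by exists y => _; split; last split.
  by exists x => -[].
pose c x := if pselect (A x) is left _ then a0 else a1.
have cA x : A (c x) by rewrite /c; case: pselect.
pose q x y := if pselect (A x /\ A y) is left _ then p x y
              else f (p (p (c x) (c y)) (p (r x) (r y))).
have crI x y : B x -> B y -> c x = c y -> r x = r y -> x = y.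
  move=> /rE[Arx [rfx rx]] /rE[Ary [rfy ry]]; rewrite /c.
  case: pselect => Ax; case: pselect => Ay // _ rxy; first by rewrite -rx// rxy ry.
  by rewrite -rfx// rxy rfy.
have pp z t z' t' : A z -> A t -> A z' -> A t' -> A (p (p z t) (p z' t')).
  by move=> Az At Az' At'; apply: (pA); exact: (pA).
have qB : pairing_on B q.
  split=> [x y Bx By|x y x' y' Bx By Bx' By'].
    rewrite /q; case: pselect => [[Ax Ay]|_]; first by left; exact: pA.
    have [Arx _] := rE _ Bx; have [Ary _] := rE _ By.
    by right; exists (p (p (c x) (c y)) (p (r x) (r y))) => //; exact: pp.
  have [Arx _] := rE _ Bx; have [Ary _] := rE _ By.
  have [Arx' _] := rE _ Bx'; have [Ary' _] := rE _ By'.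
  rewrite /q; case: pselect => [[Ax Ay]|_]; case: pselect => [[Ax' Ay']|_].
  - exact: pI.
  - move=> pf; exfalso; apply: (fN (p (p (c x') (c y')) (p (r x') (r y')))); first exact: pp.
    by rewrite -pf; exact: pA.
  - move=> fp; exfalso; apply: (fN (p (p (c x) (c y)) (p (r x) (r y)))); first exact: pp.
    by rewrite fp; exact: pA.
  - move=> /(fI _ _ (pp _ _ _ _ (cA _) (cA _) Arx Ary)
      (pp _ _ _ _ (cA _) (cA _) Arx' Ary')).
    move=> /(pI _ _ _ _ (pA _ _ (cA _) (cA _)) (pA _ _ Arx Ary)
      (pA _ _ (cA _) (cA _)) (pA _ _ Arx' Ary')) [].
    move=> /(pI _ _ _ _ (cA _) (cA _) (cA _) (cA _)) [cx cy].
    by move=> /(pI _ _ _ _ Arx Ary Arx' Ary') [rx ry]; split; exact: crI.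
have BA : B `<=` A.
  apply: (Amax _ q) => // [x|x y Ax Ay]; first by left.
  by rewrite /q; case: pselect => // -[].
by apply: (fN _ A0); apply: BA; right; exists a0.
Qed.

Definition embeds (T U : Type) := exists c : T -> U, injective c.

Lemma card_le_max (I : finType) (i0 : I) (U : Type) (C : I -> set U) :
  exists m, forall i, C i #<= C m.
Proof.
suff [m mP] : exists m, forall i, i \in enum I -> C i #<= C m.
  by exists m => i; apply: mP; rewrite mem_enum.
elim: (enum I) => [|j s [m mP]]; first by exists i0.
have [jm|mj] := card_le_total (C j) (C m).
  by exists m => i; rewrite inE => /predU1P[->//|/mP].
exists j => i; rewrite inE => /predU1P[->|/mP im]; first exact: card_lexx.
exact: card_le_trans mj.
Qed.

Lemma infinite_inhabited (T : Type) : infinite_set [set: T] -> exists x : T, True.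
Proof.
move=> /infinite_setN0[x _]; by exists x.
Qed.

Lemma embeds_finite (I : finType) (T : Type) : infinite_set [set: T] -> embeds I T.
Proof.
move=> Tinf; have [x0 _] := infinite_inhabited Tinf.
have /infiniteP/(card_leEx x0)[f [_ fI]] := Tinf.
exists (fun i => f (enum_rank i)) => i j ij; apply: enum_rank_inj; apply: val_inj.
exact: fI ij.
Qed.

Lemma infinite_two_points (T : Type) : infinite_set [set: T] ->
  exists x y : T, x <> y.
Proof.
move=> /(embeds_finite bool)[c cI].
by exists (c true), (c false) => /cI.
Qed.

(** If C m is a largest colour class, T embeds into I times C m, hence into C m times
C m, hence into C m. *)
Lemma infinite_pigeonhole (I : finType) (T : Type) (c : T -> I) :
  infinite_set [set: T] ->
  exists i (phi : T -> T), injective phi /\ forall t, c (phi t) = i.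
Proof.
move=> Tinf; have [t0 _] := infinite_inhabited Tinf.
pose C i := [set t | c t = i].
have [m Cm] := card_le_max (c t0) C.
have Cminf : infinite_set [set: C m].
  move=> fm; apply: Tinf.
  have -> : [set: T] = \bigcup_(i in [set: I]) C i by
    apply/seteqP; split=> // t _; exists (c t).
  apply: bigcup_finite => // i _; apply: card_le_finite (Cm i) _.
  by move: fm; rewrite (eq_finite_set (card_setT _)).
have [q qI] := infinite_square Cminf.
have /choice[f fP] : forall i, exists f : T -> T, (forall x, c x = i -> c (f x) = m) /\
    (forall x y, c x = i -> c y = i -> f x = f y -> x = y).
  by move=> i; exact/(card_leEx t0 (C i) (C m))/Cm.
have [e eI] := embeds_finite I Cminf.
have fm t : C m (f (c t) t) by exact: (fP (c t)).1.
exists m, (fun t => val (q (e (c t), SigSub (mem_set (fm t))))).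
split=> [x y /val_inj/qI[/eI cxy] /=|t].
  by move: (fm x) (fm y); rewrite -cxy => _ _; exact: (fP (c x)).2.
by case: (q _) => y /= /set_mem.
Qed.

Section Large.
Variable Omega : Type.
Hypothesis Omega_infinite : infinite_set [set: Omega].

(** Sets equinumerous with Omega, see [card_eq_large]. *)
Definition large (A : set Omega) :=
  exists phi : Omega -> Omega, injective phi /\ forall t, A (phi t).

Lemma card_ge_large (A : set Omega) : [set: Omega] #<= A <-> large A.
Proof.
have [x0 _] := infinite_inhabited Omega_infinite.
split=> [/(card_leEx x0)[f [fA fI]]|[f [fI fA]]].
  by exists f; split=> [x y|t]; [exact: fI|exact: fA].
by apply/(card_leEx x0); exists f; split=> // x y _ _; exact: fI.
Qed.

Lemma card_eq_large (A : set Omega) : A #= [set: Omega] <-> large A.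
Proof.
rewrite -card_ge_large; split=> [/card_esym/card_eqPle[]//|AT].
by rewrite card_eq_le card_leT AT.
Qed.

Lemma card_lt_large (A : set Omega) : A #< [set: Omega] <-> ~ large A.
Proof.
by rewrite -card_ge_large; split=> [[]//|?]; split=> //; exact: card_leT.
Qed.

Lemma sub_large (A B : set Omega) : A `<=` B -> large A -> large B.
Proof. by move=> AB [phi [pI pA]]; exists phi; split=> // t; exact: AB. Qed.

Lemma largeT : large [set: Omega]. Proof. by exists id; split. Qed.

Lemma not_large0 : ~ large (@set0 Omega).
Proof.
move=> [phi [_ phi0]]; have [x0 _] := infinite_inhabited Omega_infinite.
exact: phi0 x0.
Qed.

Lemma large_pigeonhole (I : finType) (c : Omega -> I) (A : set Omega) :
  large A -> exists i, large (A `&` [set w | c w = i]).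
Proof.
move=> [phi [pI pA]].
have [i [psi [psiI psiE]]] := infinite_pigeonhole (c \o phi) Omega_infinite.
by exists i, (phi \o psi); split=> [|t]; [exact: inj_comp|split; [exact: pA|exact: psiE]].
Qed.

Lemma large_setU (A B : set Omega) : large (A `|` B) -> large A \/ large B.
Proof.
move=> /(large_pigeonhole (fun w => `[< A w >])) [[]] /sub_large L.
  by left; apply: L => w [_ /asboolP].
by right; apply: L => w [[//|//] Aw]; move=> /asboolP.
Qed.

Lemma large_preimage_of_image (f : Omega -> Omega) (A : set Omega) :
  large (f @` A) -> large A.
Proof.
move=> [phi [pI pA]]; have /choice[psi psiE] : forall t, exists a, A a /\ f a = phi t.
  by move=> t; have [a Aa <-] := pA t; exists a.
exists psi; split=> [x y xy|t]; last exact: (psiE t).1.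
by apply: pI; rewrite -(psiE x).2 -(psiE y).2 xy.
Qed.

Lemma embeds_prod (T U : Type) : embeds T Omega -> embeds U Omega -> embeds (T * U) Omega.
Proof.
move=> [f fI] [g gI]; have [p pI] := infinite_square Omega_infinite.
by exists (fun x => p (f x.1, g x.2)) => -[t u] [t' u'] /pI[/fI -> /gI ->].
Qed.

Lemma embeds_sum (T U : Type) : embeds T Omega -> embeds U Omega -> embeds (T + U) Omega.
Proof.
move=> [f fI] [g gI]; have [p pI] := infinite_square Omega_infinite.
have [b bI] := embeds_finite bool Omega_infinite.
exists (fun x => match x with inl t => p (b true, f t) | inr u => p (b false, g u) end).
by move=> [t|u] [t'|u'] /pI[] => [/fI ->|/bI|/bI|/gI ->].
Qed.

(** Take any well-order of Omega. If some initial segment is large, the least point with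
this property has a large initial segment all of whose own initial segments are
not; embedding Omega into it and pulling the order back gives R. *)
Lemma small_well_order : exists R : Omega -> Omega -> Prop,
  [/\ well_founded R, forall x y, [\/ R x y, x = y | R y x] &
      forall x, ~ large [set y | R y x]].
Proof.
have [R Rwo] := @well_ordering_principle {classic Omega}.
pose lt (x y : Omega) := R x y /\ x <> y.
have wo_min (A : set Omega) : A !=set0 -> exists2 z, A z & forall y, A y -> z <> y -> lt z y.
  move=> [x Ax]; have /Rwo[z [[/asboolP Az zmin] _]] :
      nonempty [pred x : {classic Omega} | `[< A x >]].
    by exists x; exact/asboolP.
  exists z => // y Ay zy; split=> //; apply: zmin; exact/asboolP.
have ltA x y : lt x y -> lt y x -> False.
  move=> [xy nxy] [yx _].
  have /Rwo[z [_ zuniq]] : nonempty [pred z : {classic Omega} | (z == x) || (z == y)].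
    by exists x; rewrite inE eqxx.
  have Rxx (w : {classic Omega}) : R w w.
    have /Rwo[v [[]]] : nonempty (pred1 w) by exists w; exact/eqP.
    by move=> /eqP vw vmin _; rewrite -{1}vw; apply: vmin; exact/eqP.
  have zx : z = x.
    apply: zuniq; split; first by rewrite inE eqxx.
    by move=> u; rewrite inE => /orP[/eqP ->|/eqP ->].
  have zy : z = y.
    apply: zuniq; split; first by rewrite inE eqxx orbT.
    by move=> u; rewrite inE => /orP[/eqP ->|/eqP ->].
  by apply: nxy; rewrite -zx.
have lt_tot x y : [\/ lt x y, x = y | lt y x].
  have [xy|xy] := pselect (x = y); first exact: Or32.
  have [|z zxy zmin] := wo_min [set x; y]; first by exists x; left.
  case: zxy zmin => -> zmin; [apply: Or31|apply: Or33]; apply: zmin => //.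
  - by right.
  - by left.
  - exact: nesym.
have lt_wf : well_founded lt.
  move=> x; apply: contrapT => Nx.
  have [|z Nz zmin] := wo_min [set x | ~ Acc lt x]; first by exists x.
  apply: Nz; split=> y yz; apply: contrapT => Ny.
  have [zy|zy] := pselect (z = y); first by case: yz => _; rewrite zy.
  exact: ltA (zmin _ Ny zy) yz.
have [all_small|/existsNP[x0 /contrapT Lx0]] := pselect (forall x, ~ large [set y | lt y x]).
  by exists lt.
have [|x Lx xmin] := wo_min [set x | large [set y | lt y x]]; first by exists x0.
have [phi [phiI phix]] := Lx.
exists (fun y z => lt (phi y) (phi z)); split.
- by move=> y; apply: (Acc_inverse_image _ _ lt phi); exact: lt_wf.
- move=> y z; case: (lt_tot (phi y) (phi z)) => [|/phiI|];
    [exact: Or31|exact: Or32|exact: Or33].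
- move=> y [psi [psiI psiy]].
  have phiyx := phix y.
  apply: (ltA (phi y) x) => //; apply: xmin.
    by exists (phi \o psi); split=> //; exact: inj_comp.
  by case: phiyx => _ /nesym.
Qed.

(** Recursion along [small_well_order]: the values already taken when t is reached are
too few to exhaust A t. *)
Lemma injective_choice_Omega (A : Omega -> set Omega) : (forall t, large (A t)) ->
  exists phi : Omega -> Omega, injective phi /\ forall t, A t (phi t).
Proof.
move=> Alarge; have [R [Rwf Rtot Rsmall]] := small_well_order.
(* the option-valued function is the partial choice made before t *)
have /choice[step stepP] : forall (tr : Omega * (Omega -> option Omega)), exists y,
    A tr.1 y /\ forall s, R s tr.1 -> tr.2 s <> Some y.
  move=> [t r] /=; apply: contrapT => /forallNP N; apply: (Rsmall t).
  have [e [eI eA]] := Alarge t.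
  have /choice[s sP] : forall w, exists s, R s t /\ r s = Some (e w).
    move=> w; have /not_andP[/(_ (eA w))//|/existsNP[s /not_implyP[st /contrapT rs]]] :=
      N (e w).
    by exists s.
  exists s; split=> [x y xy|w]; last exact: (sP w).1.
  by apply: eI; have := (sP x).2; rewrite xy (sP y).2 => -[].
pose restr t (rec : forall s, R s t -> Omega) : Omega -> option Omega :=
  fun s => if pselect (R s t) is left st then Some (rec s st) else None.
pose phi := Fix Rwf (fun _ => Omega) (fun t rec => step (t, restr t rec)).
have phiE t : phi t = step (t, restr t (fun s _ => phi s)).
  rewrite {1}/phi Fix_eq// => x f g fg; congr (step (_, restr _ _)).
  by apply: functional_extensionality_dep => s; apply: functional_extensionality_dep => st.
have phiN s t : R s t -> phi s <> phi t.
  move=> st eq_phi; have [_ /(_ s st)] := stepP (t, restr t (fun s _ => phi s)).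
  by rewrite /= -phiE /restr; case: pselect => // _; rewrite eq_phi.
exists phi; split=> [s t st|t]; last by rewrite phiE; exact: (stepP (_, _)).1.
by case: (Rtot s t) => // /phiN; rewrite st.
Qed.

Lemma injective_choice (T : Type) (A : T -> set Omega) : embeds T Omega ->
  (forall t, large (A t)) ->
  exists phi : T -> Omega, injective phi /\ forall t, A t (phi t).
Proof.
move=> [c cI] Alarge.
have [|phi [phiI phiA]] := @injective_choice_Omega
    (fun w => [set x | forall t, c t = w -> A t x]).
  move=> w; have [[t tw]|Nw] := pselect (exists t, c t = w).
    by apply: sub_large (Alarge t) => x Ax t'; rewrite -tw => /cI ->.
  by apply: sub_large largeT => x _ t tw; case: Nw; exists t.
by exists (phi \o c); split=> [|t]; [exact: inj_comp|exact: phiA].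
Qed.

End Large.

(** * Extending partial injections to block permutations *)

Lemma card_eq_bijection (T : Type) (t : T) (A B : set T) : A #= B ->
  exists f : T -> T, [/\ forall x, A x -> B (f x),
    forall x y, A x -> A y -> f x = f y -> x = y &
    forall y, B y -> exists2 x, A x & f x = y].
Proof.
pose pT : pointedType := HB.pack {classic T} (isPointed.Build {classic T} t).
move=> AB; have /card_set_bijP[f [fAB fI fS]] : (A : set pT) #= (B : set pT) by [].
exists f; split=> [x|x y Ax Ay|y /fS[x Ax <-]]; last by exists x.
  exact: fAB.
by apply: fI; exact/mem_set.
Qed.

Section Extension.
Variables (Omega : Type) (n : nat) (part : Omega -> 'I_n).
Hypothesis Omega_infinite : infinite_set [set: Omega].

Definition block (i : 'I_n) : set Omega := [set w | part w = i].

Hypothesis block_large : forall i, large (block i).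

(** The elements of the stabiliser of the partition, with the permutation of the parts
that they induce made explicit, see [permuting_Stab]. *)
Definition permuting (pi : {perm 'I_n}) (b : Omega -> Omega) :=
  bijective b /\ forall w, part (b w) = pi (part w).

Definition spread (T : Type) (x : T -> Omega) :=
  forall j, large (block j `&` ~` range x).

Lemma sub_spread (T U : Type) (x : T -> Omega) (y : U -> Omega) :
  range x `<=` range y -> spread y -> spread x.
Proof.
move=> xy ys j; apply: sub_large (ys j) => w [wj Nw]; split=> // /xy.
exact: Nw.
Qed.

(** Enlarging the family by |Omega| copies of each block reserves a large part of it. *)
Lemma spread_choice (T : Type) (A : T -> set Omega) : embeds T Omega ->
  (forall t, large (A t)) ->
  exists x : T -> Omega, [/\ injective x, spread x & forall t, A t (x t)].
Proof.
move=> Temb Alarge.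
have Uemb : embeds (T + Omega * 'I_n) Omega.
  apply: embeds_sum => //; apply: embeds_prod => //; first by exists id.
  exact: embeds_finite.
have [|x [xI xA]] := injective_choice (A := fun u =>
    match u with inl t => A t | inr wj => block wj.2 end) Uemb.
  by case.
exists (x \o inl); split=> [t u /xI[]//|j|t]; last exact: xA (inl t).
exists (fun w => x (inr (w, j))); split=> [w v /xI[]//|w].
by split=> [|[t _ /xI]//]; exact: xA (inr (w, j)).
Qed.

(** What x leaves of block j and what y leaves of block pi j are both large, hence in
bijection. *)
Lemma extend_permuting (pi : {perm 'I_n}) (T : Type) (x y : T -> Omega) :
  injective x -> injective y -> spread x -> spread y ->
  (forall t, part (y t) = pi (part (x t))) ->
  exists b, permuting pi b /\ forall t, b (x t) = y t.
Proof.
move=> xI yI xs ys xy; have [w0 _] := infinite_inhabited Omega_infinite.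
have /choice[c cP] : forall j, exists f : Omega -> Omega,
   [/\ forall w, (block j `&` ~` range x) w -> (block (pi j) `&` ~` range y) (f w),
    forall w v, (block j `&` ~` range x) w -> (block j `&` ~` range x) v ->
      f w = f v -> w = v &
    forall v, (block (pi j) `&` ~` range y) v ->
      exists2 w, (block j `&` ~` range x) w & f w = v].
  move=> j; apply: (card_eq_bijection w0).
  have /(card_eq_large Omega_infinite)/card_esym ey := ys (pi j).
  have /(card_eq_large Omega_infinite) ex := xs j.
  exact: card_eq_trans ex ey.
have /choice[b bP] : forall w, exists v, (forall t, x t = w -> v = y t) /\
    (~ range x w -> v = c (part w) w).
  move=> w; have [[t _ tw]|Nw] := pselect (range x w); last first.
    by exists (c (part w) w); split=> // t tw; case: Nw; exists t.
  by exists (y t); split=> [u uw|/(_ _)[]]; [rewrite -tw in uw; rewrite (xI _ _ uw)|exists t].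
have bx t : b (x t) = y t by exact: (bP _).1.
have bc w : ~ range x w -> b w = c (part w) w by exact: (bP _).2.
have cy w : ~ range x w -> (block (pi (part w)) `&` ~` range y) (c (part w) w).
  by move=> Nw; have [cB _ _] := cP (part w); exact: cB.
have bpart w : part (b w) = pi (part w).
  have [[t _ <-]|Nw] := pselect (range x w); first by rewrite bx.
  by rewrite bc//; case: (cy w Nw).
exists b; split=> //; split=> //; rewrite -setTT_bijective; split=> //.
- move=> w v _ _; have [[t _ <-]|Nw] := pselect (range x w);
    have [[u _ <-]|Nv] := pselect (range x v); rewrite ?bx ?bc//.
  + by move/yI ->.
  + by move=> e; case: (cy v Nv) => _ []; exists t.
  + by move=> e; case: (cy w Nw) => _ []; exists u.
  + move=> e; have pwv : part w = part v.
      by apply: (@perm_inj _ pi); rewrite -!bpart !bc// e.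
    have [_ cI _] := cP (part w).
    apply: (cI w v (conj erefl Nw) (conj (esym pwv) Nv)).
    by rewrite e pwv.
- move=> v _; have [[t _ <-]|Nv] := pselect (range y v); first by exists (x t).
  have [_ _ cS] := cP (perm_inv pi (part v)).
  have [|w [wj Nw] wv] := cS v; first by split=> //; rewrite /block /= permKV.
  by exists w => //; rewrite bc// wj.
Qed.

(** Any |Omega| requirements of the form: b maps some point of A t to some point of C t,
can be met at once, with distinct points for distinct t. *)
Lemma linking_permutation (pi : {perm 'I_n}) (T : Type) (j : T -> 'I_n)
    (A C : T -> set Omega) : embeds T Omega ->
  (forall t, large (A t)) -> (forall t, large (C t)) ->
  (forall t, A t `<=` block (j t)) -> (forall t, C t `<=` block (pi (j t))) ->
  exists b (x y : T -> Omega), [/\ permuting pi b, injective x, injective y &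
    forall t, [/\ A t (x t), C t (y t) & b (x t) = y t]].
Proof.
move=> Temb LA LC Aj Cj.
have [x [xI xs xA]] := spread_choice Temb LA.
have [y [yI ys yC]] := spread_choice Temb LC.
have [|b [bpi bxy]] := @extend_permuting pi T x y xI yI xs ys.
  by move=> t; rewrite (Cj _ _ (yC t)) (Aj _ _ (xA t)).
by exists b, x, y; split.
Qed.

End Extension.

(** * Generating the full transformation semigroup *)

Section Crossing.
Variables (Omega : Type) (n : nat) (part : Omega -> 'I_n).
Hypothesis Omega_infinite : infinite_set [set: Omega].
Hypothesis block_large : forall i, large (block part i).

Lemma permuting_inv pi b : permuting part pi b ->
  exists2 b', permuting part (pi^-1)%g b' & cancel b b'.
Proof.
move=> [[b' bK b'K] bpart]; exists b' => //; split; first by exists b.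
by move=> w; rewrite -{2}(b'K w) bpart permK.
Qed.

Section Semigroup.
Variable M : set (Omega -> Omega).
Hypothesis M_mul : mul_closed M.
Hypothesis M_permuting : forall pi b, permuting part pi b -> M b.

(** Let D be the set of blocks of which F misses a large part, and suppose that k is not
in D. Then F meets block k in a large set, which comes, up to a large subset, from a
single block i. For j in D, a permutation b exchanging the blocks j and i can send
points missed by F to points of block i whose images are in block k; then F b F
misses these images, besides all that F misses. *)
Lemma spread_injection f : M f -> injective f -> large (~` range f) ->
  exists F, [/\ M F, injective F & spread part F].
Proof.
move=> Mf fI flarge.
pose D (F : Omega -> Omega) : {set 'I_n} :=
  finset.finset (fun j => `[< large (block part j `&` ~` range F) >]).
have DP F j : reflect (large (block part j `&` ~` range F)) (j \in D F).
  by rewrite finset.inE; exact: asboolP.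
suff /(_ n (leqnn n))[F [MF FI _ DF]] m : (m <= n)%N -> exists F,
    [/\ M F, injective F, exists j, j \in D F & (m <= #|D F|)%N].
  exists F; split=> // j; apply/DP.
  have /eqP -> : D F == finset.setTfor 'I_n; last by rewrite finset.inE.
  by rewrite eqEcard finset.subsetT cardsT card_ord.
elim: m => [_|m IH mn].
  exists f; split=> //.
  have [i Li] := large_pigeonhole Omega_infinite part flarge.
  by exists i; apply/DP; rewrite setIC.
have [|F [MF FI [j Dj] DF]] := IH; first exact: ltnW.
have [mDF|DFm] := ltnP m #|D F|; first by exists F; split=> //; exists j.
have [k Nk] : exists k, k \notin D F.
  apply/existsP; rewrite -negb_forall; apply/negP => /forallP DT.
  suff : (n <= #|D F|)%N by move=> nD;
    move: (leq_ltn_trans (leq_trans nD DFm) mn); rewrite ltnn.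
  rewrite -[X in (X <= _)%N](card_ord n) -cardsT; apply/subset_leq_card/fintype.subsetP => i _.
  exact: DT.
have [i Li] : exists i, large [set w | part w = i /\ part (F w) = k].
  have /(large_setU Omega_infinite)[] : large (F @` [set w | part (F w) = k] `|`
      (block part k `&` ~` range F)).
    apply: sub_large (block_large k) => w wk.
    have [[v _ vw]|Nw] := pselect (range F w); last by right.
    by left; exists v => //=; rewrite vw.
  - move=> /large_preimage_of_image/(large_pigeonhole Omega_infinite part)[i Li].
    by exists i; apply: sub_large Li => w [].
  - by move=> /DP; rewrite (negbTE Nk).
have [|||||b [x [y [bpi xI yI xy]]]] := @linking_permutation Omega n part Omega_infinite
  block_large (tperm j i) Omega (fun=> j) (fun=> block part j `&` ~` range F)
  (fun=> [set w | part w = i /\ part (F w) = k]).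
- by exists id.
- by move=> _; apply/DP.
- by [].
- by move=> _ w [].
- by move=> _ w []; rewrite tpermL.
have [bbij bpart] := bpi.
exists (F \o b \o F); split.
- by apply: (M_mul) => //; apply: (M_mul) => //; exact: M_permuting bpi.
- by apply: inj_comp => //; apply: inj_comp => //; exact: bij_inj.
- exists j; apply/DP; apply: sub_large (elimT (DP _ _) Dj) => w [wj Nw]; split=> // -[v _ vw].
  by apply: Nw; exists (b (F v)).
apply: (leq_ltn_trans DF).
apply: (leq_trans (_ : _ <= #|k |: D F|)%N); first by rewrite cardsU1 Nk.
apply/subset_leq_card/fintype.subsetP => l /finset.setU1P[->|/DP Dl]; apply/DP; last first.
  by apply: sub_large Dl => w [wl Nw]; split=> // -[v _ vw]; apply: Nw; exists (b (F v)).
exists (F \o y); split=> [|t]; first exact: inj_comp.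
have [[xj Nx] [yi yk] bxy] := xy t; split=> // -[v _ /FI].
rewrite /= -bxy => /(bij_inj bbij) Fvx; apply: Nx; by exists v.
Qed.

End Semigroup.

Variable M : set (Omega -> Omega).
Hypothesis M_mul : mul_closed M.
Hypothesis M_permuting : forall pi b, permuting part pi b -> M b.

(** The sections of elements of M form a semigroup, because a product of sections is a
section of the product in reverse order. It contains the block permutations, so
that [spread_injection] applies to it. *)
Lemma spread_section g t : M g -> cancel t g -> large (~` range t) ->
  exists G s, [/\ M G, cancel s G & spread part s].
Proof.
move=> Mg tg tlarge.
pose S := [set s : Omega -> Omega | exists2 u, M u & cancel s u].
have S_mul : mul_closed S.
  move=> s1 s2 [u1 Mu1 s1u] [u2 Mu2 s2u]; exists (u1 \o u2); first exact: M_mul.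
  by move=> w; rewrite /= s2u s1u.
have S_permuting pi b : permuting part pi b -> S b.
  move=> /permuting_inv[b' b'pi bK]; exists b' => //; exact: M_permuting b'pi.
have [||s [[G MG sG] _ sspread]] := spread_injection S_mul S_permuting _ _ tlarge.
- by exists g.
- exact: can_inj tg.
by exists G, s.
Qed.

(** This is membership of (i, j) in rho(u), see [crosses_rho], witnessed by points of
block i rather than by their images. *)
Definition crosses (u : Omega -> Omega) i j := exists x : Omega -> Omega,
  [/\ forall t, part (x t) = i, forall t, part (u (x t)) = j & injective (u \o x)].

Lemma crosses_rho P u i j : P = block part -> rho P u (i, j) <-> crosses u i j.
Proof.
move=> ->; rewrite /rho /= (card_eq_large Omega_infinite); split.
  move=> [phi [pI pA]]; have /choice[x xP] : forall t, exists v, part v = i /\ u v = phi t.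
    by move=> t; have [[v vi vt] _] := pA t; exists v.
  exists x; split=> [t|t|t s /=]; first exact: (xP t).1.
    by rewrite (xP t).2; exact: (pA t).2.
  by rewrite !(xP _).2 => /pI.
move=> [x [xi xj xI]]; exists (u \o x); split=> // t; split; last exact: xj.
by exists (x t); first exact: xi.
Qed.

Lemma crosses_comp u v i k : crosses (v \o u) i k -> exists2 j, crosses u i j & crosses v j k.
Proof.
move=> [x [xi xk xI]].
have [j [psi [psiI psij]]] := infinite_pigeonhole (fun t => part (u (x t))) Omega_infinite.
exists j.
  exists (x \o psi); split=> [t|t|s t /= e]; [exact: xi|exact: psij|].
  by apply: psiI; apply: xI; rewrite /= e.
exists (u \o x \o psi); split=> [t|t|]; [exact: psij|exact: xk|exact: (inj_comp xI)].
Qed.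

(** For all i, j, k at once, b links the large set of images under u of points of block
i in block j to a set of points of block pi j on which v is injective with values in
block k. *)
Lemma crosses_twisted u v (pi : {perm 'I_n}) : exists2 b, permuting part pi b &
  forall i j k, crosses u i j -> crosses v (pi j) k -> crosses (v \o b \o u) i k.
Proof.
have /choice[X XP] : forall jk : 'I_n * 'I_n, exists x : Omega -> Omega,
    crosses v jk.1 jk.2 ->
    [/\ forall t, part (x t) = jk.1, forall t, part (v (x t)) = jk.2 & injective (v \o x)].
  move=> jk; have [[x xP]|N] := pselect (crosses v jk.1 jk.2); first by exists x.
  by exists id.
pose A (t : Omega * 'I_n * 'I_n * 'I_n) := let: (w, i, j, k) := t in
  [set w | part w = j /\ (crosses u i j -> exists2 v, part v = i & u v = w)].
pose C (t : Omega * 'I_n * 'I_n * 'I_n) := let: (w, i, j, k) := t in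
  [set w | part w = pi j /\ (crosses v (pi j) k -> range (X (pi j, k)) w)].
have [|||||b [x [y [bpi xI yI xy]]]] := @linking_permutation Omega n part Omega_infinite
  block_large pi _ (fun t => t.1.2) A C.
- have emb : embeds Omega Omega by exists id.
  by do 3!(apply: embeds_prod => //; last exact: embeds_finite).
- move=> [[[w i] j] k]; have [[z [zi zj zI]]|N] := pselect (crosses u i j).
    exists (u \o z); split=> // t; split=> [|_]; first exact: zj.
    by exists (z t).
  by apply: sub_large (block_large j) => w' w'j; split.
- move=> [[[w i] j] k]; have [m|N] := pselect (crosses v (pi j) k).
    have [Xj Xk XI] := XP (pi j, k) m.
    exists (X (pi j, k)); split=> [s t e|t]; first by apply: XI; rewrite /= e.
    by split=> // _; exists t.
  by apply: sub_large (block_large (pi j)) => w' w'j; split.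
- by move=> [[[w i] j] k] w' [].
- by move=> [[[w i] j] k] w' [].
exists b => // i j k uij vjk.
have [Xj Xk XI] := XP (pi j, k) vjk.
have /choice[z zP] : forall w, exists z, part z = i /\ u z = x (w, i, j, k).
  move=> w; have [[_ /(_ uij)[z zi zx]] _ _] := xy (w, i, j, k).
  by exists z.
exists z; split=> [t|t|t s /=]; first exact: (zP t).1.
  rewrite /= (zP t).2; have [_ [_ /(_ vjk)[s _ <-]] ->] := xy (t, i, j, k).
  exact: Xk.
rewrite !(zP _).2; have [_ [_ /(_ vjk)[s1 _ e1]] ->] := xy (t, i, j, k).
have [_ [_ /(_ vjk)[s2 _ e2]] ->] := xy (s, i, j, k).
by rewrite -e1 -e2 => /XI e; move: e1; rewrite e e2 => /yI[].
Qed.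

Lemma met_relations_closed :
  twisted_closed (fun r => exists2 u, M u & forall i j, r i j -> crosses u i j).
Proof.
move=> r s pi [u Mu ur] [v Mv vs]; have [b bpi bP] := crosses_twisted u v pi.
exists (fun i k => crosses (v \o b \o u) i k).
  exists (v \o b \o u) => //; apply: (M_mul) => //; apply: (M_mul) => //.
  exact: M_permuting bpi.
by move=> i j k /ur uij /vs vjk; exact: bP vjk.
Qed.

Lemma exists_full_column P u : P = block part -> M u ->
  total_relation (rho P u) -> ~ SymRel (rho P u) ->
  exists c, exists2 v, M v & forall i, crosses v i c.
Proof.
move=> PE Mu tot Nsym; have [i1 [i2 [j [i12 r1 r2]]]] := shared_column tot Nsym.
have mtot : forall i, exists j, crosses u i j.
  by move=> i'; have [k /(crosses_rho _ _ _ PE)] := tot i'; exists k.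
have [s [v Mv vs] [c sc]] := full_column met_relations_closed
  (ex_intro2 _ _ u Mu (fun _ _ => id)) mtot i12
  (iffLR (crosses_rho _ _ _ PE) r1) (iffLR (crosses_rho _ _ _ PE) r2).
by exists c, v => // i; exact: vs.
Qed.

(** [full_column] for the inverse relations, a family that is closed in the same sense
with pi replaced by its inverse. *)
Lemma exists_full_row P u : P = block part -> M u ->
  total_relation (rho P u)^-1%relation -> ~ SymRel (rho P u) ->
  exists l, exists2 v, M v & forall j, crosses v l j.
Proof.
move=> PE Mu tot Nsym.
have [i1 [i2 [j [i12 r1 r2]]]] := shared_column tot (fun h => Nsym (iffLR (SymRel_inv _) h)).
have Ccl : twisted_closed (fun r => exists2 u, M u & forall i j, r j i -> crosses u i j).
  move=> r s pi Cr Cs; have [v [w Mw wv] vP] := met_relations_closed (pi^-1)%g Cs Cr.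
  exists (fun k i => v i k); first by exists w.
  by move=> i k l rik skl; apply: (vP _ (pi k)) => //=; rewrite permK.
have mtot : forall i, exists j, crosses u j i.
  by move=> i'; have [k /(crosses_rho _ _ _ PE)] := tot i'; exists k.
have [s [v Mv vs] [c sc]] := full_column Ccl
  (ex_intro2 _ _ u Mu (fun _ _ => id)) mtot i12
  (iffLR (crosses_rho _ _ _ PE) r1) (iffLR (crosses_rho _ _ _ PE) r2).
by exists c, v => // i; exact: vs.
Qed.

End Crossing.

Section Small.
Variable Omega : Type.
Hypothesis Omega_infinite : infinite_set [set: Omega].

Lemma infinite_moieties : exists h h' : Omega -> Omega,
  [/\ injective h, injective h' & forall s t, h s <> h' t].
Proof.
have idE : embeds Omega Omega by exists id.
have [c cI] := embeds_sum Omega_infinite idE idE.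
by exists (c \o inl), (c \o inr); split=> [s t /cI[]|s t /cI[]|s t /cI].
Qed.

(** The larger of the two sets is finite, or equinumerous with its square. *)
Lemma small_setX (T U : Type) (A : set T) (B : set U) :
  ~ ([set: Omega] #<= A) -> ~ ([set: Omega] #<= B) -> ~ ([set: Omega] #<= A `*` B).
Proof.
have [x0 _] := infinite_inhabited Omega_infinite.
suff H V W (C : set V) (D : set W) (f : T * U -> V * W) : C #<= D ->
    ~ ([set: Omega] #<= D) -> injective f -> (forall x, (A `*` B) x -> (C `*` D) (f x)) ->
    ~ ([set: Omega] #<= A `*` B).
  move=> NA NB; have [AB|BA] := card_le_total A B; first exact: (H _ _ _ _ id AB).
  apply: (H _ _ _ _ (fun x => (x.2, x.1)) BA) => // [[x y] [x' y'] [-> ->]//|[x y] []//].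
move=> CD ND fI fAB OAB.
have OCD : [set: Omega] #<= C `*` D.
  apply: card_le_trans OAB _; have [AB0|/set0P[ab _]] := eqVneq (A `*` B) set0.
    by rewrite AB0; exact: card_ge0.
  by apply/(card_leEx (f ab)); exists f; split=> // x y _ _; exact: fI.
have [Dfin|Dinf] := pselect (finite_set D).
  apply: Omega_infinite; apply: card_le_finite OCD _; apply: finite_setX => //.
  exact: card_le_finite CD _.
apply: ND; apply: (card_le_trans OCD).
have [d0 Dd0] := infinite_setN0 Dinf.
have /(card_leEx d0)[i [iD iI]] := CD.
have [|q qI] := @infinite_square D.
  by rewrite (eq_finite_set (card_setT _)).
have /choice[e eP] : forall x, exists d : D, D x -> val d = x.
  move=> x; have [Dx|N] := pselect (D x); first by exists (SigSub (mem_set Dx)).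
  by exists (SigSub (mem_set Dd0)).
apply/(card_leEx d0); exists (fun x => val (q (e (i x.1), e x.2))).
split=> [x _|[x y] [x' y'] [/= Cx Dy] [/= Cx' Dy'] /val_inj/qI[ex ey]].
  by case: (q _) => y /= /set_mem.
have := congr1 val ex; have := congr1 val ey; rewrite !eP//; do ?exact: iD.
by move=> -> /iI ->.
Qed.

(** A singular cardinal is a limit: if A times B bounded all smaller cardinals, Omega, a
union of few small sets, would embed into the product of two small sets. *)
Lemma singular_limit (T U : Type) (A : set T) (B : set U) : ~ regular_card Omega ->
  ~ ([set: Omega] #<= A) -> ~ ([set: Omega] #<= B) ->
  exists N : set Omega, N #< [set: Omega] /\ ~ (N #<= A `*` B).
Proof.
move=> Nreg NA NB; apply: contrapT => NN.
have small (N : set Omega) : N #< [set: Omega] -> N #<= A `*` B.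
  by move=> Ns; apply: contrapT => ?; apply: NN; exists N.
apply: Nreg => I F Is Fs; move=> FT.
have [x0 _] := infinite_inhabited Omega_infinite.
apply: (small_setX (small_setX NA NB) Is.2).
have [AB0|/set0P[ab _]] := eqVneq (A `*` B) set0.
  have [i Ii] : (\bigcup_(i in I) F i) x0 by rewrite FT.
  by have := small _ (Fs i Ii); rewrite AB0 => /card_le0P ->.
have /choice[f fP] : forall i, exists f : Omega -> T * U, I i ->
    (forall x, F i x -> (A `*` B) (f x)) /\
    (forall x y, F i x -> F i y -> f x = f y -> x = y).
  move=> i; have [Ii|N] := pselect (I i); last by exists (fun=> ab).
  by have /(card_leEx ab)[f fP] := small _ (Fs i Ii); exists f.
have /choice[k kP] : forall x, exists i, I i /\ F i x.
  by move=> x; have [i Ii Fx] : (\bigcup_(i in I) F i) x; [rewrite FT|exists i].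
apply/(card_leEx (ab, x0)); exists (fun x => (f (k x) x, k x)).
split=> [x _|x y _ _ [fxy kxy]].
  by split; [exact: (fP _ (kP x).1).1 (kP x).2|exact: (kP x).1].
apply: (fP _ (kP x).1).2 => //; first exact: (kP x).2.
  by rewrite kxy; exact: (kP y).2.
by rewrite fxy kxy.
Qed.

End Small.

Section Fibers.
Variables (Omega : Type) (n : nat) (part : Omega -> 'I_n).
Hypothesis Omega_infinite : infinite_set [set: Omega].
Hypothesis block_large : forall i, large (block part i).
Variable M : set (Omega -> Omega).
Hypothesis M_mul : mul_closed M.
Hypothesis M_permuting : forall pi b, permuting part pi b -> M b.

Definition fiber (i : 'I_n) (u : Omega -> Omega) a : set Omega :=
  [set v | part v = i /\ u v = a].

Definition large_fibers u i := large [set a | large (fiber i u a)].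

(** Between u and G put a permutation that sends, for every a, some image under u of a
point of block l to the value s(a) of the section. *)
Lemma section_into_block u G s l : M u -> (forall j, crosses part u l j) ->
  M G -> cancel s G -> spread part s ->
  exists w z, [/\ M w, cancel z w, forall a, part (z a) = l & spread part z].
Proof.
move=> Mu ul MG sG sspread.
(* the points indexed by false are there only to be missed by the section *)
pose A (t : Omega * bool) := [set x | part x = part (s t.1) /\ exists2 v, part v = l & u v = x].
have Temb : embeds (Omega * bool) Omega.
  by apply: embeds_prod => //; [exists id|exact: embeds_finite].
have LA t : large (A t).
  have [z [zl zs zI]] := ul (part (s t.1)).
  exists (u \o z); split=> // t'; split; first exact: zs.
  by exists (z t').
have [x [xI xspread xA]] := spread_choice Omega_infinite block_large Temb LA.
have /choice[v vP] : forall t, exists v, part v = l /\ u v = x t.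
  by move=> t; have [_ [v vl vx]] := xA t; exists v.
have [||||b [bpi bxs]] := extend_permuting Omega_infinite (pi := 1%g)
  (x := fun a => x (a, true)) (y := s) _ _ _ sspread.
- by move=> a a' /xI[].
- exact: can_inj sG.
- by apply: sub_spread xspread => _ [a _ <-]; exists (a, true).
- by move=> a; rewrite perm1; case: (xA (a, true)).
exists (G \o b \o u), (fun a => v (a, true)); split.
- by apply: (M_mul) => //; apply: (M_mul) => //; exact: M_permuting bpi.
- by move=> a; rewrite /= (vP _).2 bxs sG.
- by move=> a; exact: (vP _).1.
move=> j; have [->|/eqP jl] := eqVneq j l.
  exists (fun a => v (a, false)); split=> [a a' /(congr1 u)|a].
    by rewrite !(vP _).2 => /xI[].
  split; first exact: (vP _).1.
  by move=> [a' _ /(congr1 u)]; rewrite !(vP _).2 => /xI[].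
apply: sub_large (block_large j) => w wj; split=> // -[a _ aw]; apply: jl.
by rewrite -wj -aw (vP _).1.
Qed.

(** Two steps: u b G has a large number of fibres that are large in every block; a second
permutation b' sends the points under these fibres to the values of the section z
of w, and every point of Omega becomes the image of one of them. *)
Lemma full_fibers u c G l w z k : M u -> (forall i, crosses part u i c) ->
  M G -> large_fibers G l ->
  M w -> cancel z w -> (forall a, part (z a) = k) -> spread part z ->
  exists2 H, M H & forall i a, large (fiber i H a).
Proof.
move=> Mu uc MG [e0 [e0I e0P]] Mw zw zk zspread.
have [m [psi [psiI psim]]] := infinite_pigeonhole (fun t => part (e0 t)) Omega_infinite.
pose e := e0 \o psi; have eI : injective e by exact: inj_comp.
have eP a : large (fiber l G (e a)) by exact: e0P.
have [h [h' [hI h'I hh']]] := infinite_moieties Omega_infinite.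
(* using only the points e (h a) leaves a large part of block m free *)
pose A (t : Omega * 'I_n * Omega) := [set x |
  part x = c /\ exists2 v, part v = t.1.2 & u v = x].
pose C (t : Omega * 'I_n * Omega) := fiber l G (e t.1.1).
have [|||||b [x [y [bpi xI yI xy]]]] := linking_permutation Omega_infinite
  block_large (pi := tperm c l) (j := fun=> c) (A := A) (C := C).
- have emb : embeds Omega Omega by exists id.
  by do 2!(apply: embeds_prod => //); exact: embeds_finite.
- move=> [[a i] t]; have [z' [zi zc zI]] := uc i.
  exists (u \o z'); split=> // t'; split; first exact: zc.
  by exists (z' t').
- by move=> t; exact: eP.
- by move=> t v [].
- by move=> t v []; rewrite tpermL.
have G1P a i : large (fiber i (G \o b \o u) (e a)).
  have /choice[v vP] : forall t, exists v, part v = i /\ u v = x (a, i, t).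
    by move=> t; have [[_ [v vi vx]] _ _] := xy (a, i, t); exists v.
  exists v; split=> [s t st|t].
    by have := (vP s).2; rewrite st (vP t).2 => /xI[].
  split; first exact: (vP t).1.
  have [_ [_ Gy] bxy] := xy (a, i, t).
  by rewrite /= (vP t).2 bxy.
have [|||b' [b'pi b'ez]] := extend_permuting Omega_infinite (pi := tperm m k)
  (x := e \o h) (y := z) _ (can_inj zw) _ zspread.
- exact: inj_comp.
- move=> j; have [->|/eqP jm] := eqVneq j m.
    exists (e \o h'); split=> [|t]; first exact: inj_comp.
    split; first exact: psim.
    by move=> [s _ /eI]; exact: hh'.
  apply: sub_large (block_large j) => v vj; split=> // -[a _ av]; apply: jm.
  by rewrite -vj -av psim.
- by move=> t; rewrite zk psim tpermL.
exists (w \o b' \o (G \o b \o u)).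
  by apply: (M_mul); apply: (M_mul) => //;
    [apply: (M_mul) => //; exact: M_permuting bpi|exact: M_permuting b'pi].
move=> i a; apply: sub_large (G1P (h a) i) => v [vi ve]; split=> //=.
by rewrite /= in ve; rewrite ve b'ez zw.
Qed.

(** The value of b at F t is chosen in the fibre of H over f t. *)
Lemma all_maps F H : M F -> injective F -> spread part F ->
  M H -> (forall i a, large (fiber i H a)) -> M = setT.
Proof.
move=> MF FI Fspread MH Hfull; apply/seteqP; split=> // f _.
have emb : embeds Omega Omega by exists id.
have [y [yI yspread yP]] := spread_choice Omega_infinite block_large emb
  (fun t => Hfull (part (F t)) (f t)).
have [|b [bpi bxy]] := extend_permuting Omega_infinite (pi := 1%g) FI yI Fspread yspread.
  by move=> t; rewrite perm1 (yP t).1.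
have -> : f = H \o b \o F.
  by apply: functional_extensionality_dep => t; rewrite /= bxy (yP t).2.
by apply: (M_mul) => //; apply: (M_mul) => //; exact: M_permuting bpi.
Qed.

(** One of the finitely many blocks meets a large fibre in a large set, and the same
block serves for a large number of fibres. *)
Lemma regular_large_fibers g : large (contraction_set g [set: Omega]) ->
  exists l, large_fibers g l.
Proof.
move=> [e [eI eP]].
have /choice[l lP] : forall t, exists l, large (fiber l g (e t)).
  move=> t; have /(card_ge_large Omega_infinite) := eP t.
  move=> /(large_pigeonhole Omega_infinite part)[l Ll]; exists l.
  by apply: sub_large Ll => v [].
have [i [psi [psiI psil]]] := infinite_pigeonhole l Omega_infinite.
exists i, (e \o psi); split=> [|t]; first exact: inj_comp.
by have := lP (psi t); rewrite psil.
Qed.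

(** Otherwise every pair of blocks fails from some cardinal on. Let N0 be the largest of
these finitely many cardinals and N1 one that exceeds n times N0. A fibre of size N1
meets some block in at least N0 points, so one pair of blocks works for N0 after
all. *)
Lemma singular_uniform_blocks g : ~ regular_card Omega ->
  (forall N : set Omega, N #< [set: Omega] -> large (contraction_set g N)) ->
  exists m l, forall N : set Omega, N #< [set: Omega] ->
    large [set a | part a = m /\ N #<= fiber l g a].
Proof.
move=> Nreg gP.
pose X m l (N : set Omega) := [set a | part a = m /\ N #<= fiber l g a].
suff [[m l] mlP] : exists ml : 'I_n * 'I_n, forall N : set Omega, N #< [set: Omega] ->
    large (X ml.1 ml.2 N).
  by exists m, l.
apply: contrapT => /forallNP N.
have /choice[N0 N0P] : forall ml : 'I_n * 'I_n, exists N : set Omega,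
    N #< [set: Omega] /\ ~ large (X ml.1 ml.2 N).
  by move=> ml; have /existsNP[N' /not_implyP[]] := N ml; exists N'.
have [w0 _] := infinite_inhabited Omega_infinite.
have [ml0 ml0P] := card_le_max (part w0, part w0) N0.
have [|||N1 [N1s N1P]] := @singular_limit _ Omega_infinite 'I_n Omega setT (N0 ml0) => //.
- move=> /card_le_finite fO; apply: Omega_infinite; apply: fO; exact: finite_finset.
- exact: (N0P ml0).1.2.
have [e [eI eP]] := gP N1 N1s.
have /choice[l lP] : forall t, exists l, N0 ml0 #<= fiber l g (e t).
  move=> t; apply: contrapT => /forallNP small; apply: N1P.
  apply: (card_le_trans (eP t)).
  have [|/set0P[v0 _]] := eqVneq (g @^-1` [set e t]) set0.
    by move=> ->; exact: card_ge0.
  have /choice[f fP] : forall i, exists f : Omega -> Omega,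
      (forall x, fiber i g (e t) x -> N0 ml0 (f x)) /\
      (forall x y, fiber i g (e t) x -> fiber i g (e t) y -> f x = f y -> x = y).
    move=> i; apply/(card_leEx v0).
    by case: (card_le_total (fiber i g (e t)) (N0 ml0)) => // /small.
  apply/(card_leEx (part v0, v0)); exists (fun x => (part x, f (part x) x)).
  split=> [x gx|x y gx gy [pxy]].
    by split=> //=; apply: (fP _).1.
  by rewrite pxy; apply: (fP _).2.
have [[m' l'] [psi [psiI psiP]]] :=
  infinite_pigeonhole (fun t => (part (e t), l t)) Omega_infinite.
apply: (N0P (m', l')).2; exists (e \o psi); split=> [|t]; first exact: inj_comp.
have [<- <-] := psiP t; split=> //=.
by apply: (card_le_trans (ml0P _)); exact: lP.
Qed.

(** Write Omega as the union of the small sets F i, for i in a small set I. A large number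
of fibres of g have at least |I| elements in block l. Sending to |I| of them, one
for each i, points whose own fibres have at least |F i| elements in block l makes
the corresponding fibre of g b g large. *)
Lemma singular_large_fibers g : M g -> singular_card Omega ->
  (forall N : set Omega, N #< [set: Omega] -> large (contraction_set g N)) ->
  exists2 h, M h & exists l, large_fibers h l.
Proof.
move=> Mg [_ Nreg] gP; have [m [l mlP]] := singular_uniform_blocks Nreg gP.
have /existsNP[I /existsNP[F /not_implyP[Is /not_implyP[Fs /contrapT FT]]]] := Nreg.
have [w0 _] := infinite_inhabited Omega_infinite.
have [i0 Ii0] : exists i, I i.
  by have [i Ii _] : (\bigcup_(i in I) F i) w0; [rewrite FT|exists i].
have [h [h' [hI h'I hh']]] := infinite_moieties Omega_infinite.
have [e [eI eP]] := mlP I Is.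
have /choice[r rP] : forall a, exists f : Omega -> Omega,
    (forall i, I i -> fiber l g (e a) (f i)) /\
    (forall i j, I i -> I j -> f i = f j -> i = j).
  by move=> a; apply/(card_leEx w0); exact: (eP a).2.
(* h' provides the fibres whose points the permutation leaves free *)
pose T := (Omega * {i | I i})%type.
have Temb : embeds T Omega.
  apply: embeds_prod => //; first by exists id.
  by exists sval => -[i Ii] [j Ij] /= ij; exact/eq_exist.
pose x (t : T) := r (h t.1) (sval t.2).
have xg t : fiber l g (e (h t.1)) (x t) by apply: (rP _).1; exact: (svalP t.2).
have xI : injective x.
  move=> [a [i Ii]] [a' [j Ij]] xx.
  have [_ g1] := xg (a, exist _ i Ii); have [_ g2] := xg (a', exist _ j Ij).
  have aa : a = a' by apply: hI; apply: eI; rewrite -g1 -g2 xx.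
  congr (_, _); first by [].
  by apply: eq_exist; apply: ((rP (h a)).2 _ _ Ii Ij); move: xx; rewrite /x /= aa.
have xspread : spread part x.
  move=> j; have [->|/eqP jl] := eqVneq j l.
    exists (fun a => r (h' a) i0); split=> [a a' aa|a].
      have [_ g1] := (rP (h' a)).1 _ Ii0; have [_ g2] := (rP (h' a')).1 _ Ii0.
      by apply: h'I; apply: eI; rewrite -g1 -g2 aa.
    have [rl g1] := (rP (h' a)).1 _ Ii0; split=> // -[t _ tr].
    have [_ g2] := xg t; move: g2; rewrite tr g1 => /eI/esym; exact: hh'.
  apply: sub_large (block_large j) => v vj; split=> // -[t _ tv]; apply: jl.
  by rewrite -vj -tv (xg t).1.
have [y [yI yspread yP]] := spread_choice Omega_infinite block_large Temb
  (fun t => mlP _ (Fs _ (svalP t.2))).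
have [|b [bpi byx]] := extend_permuting Omega_infinite (pi := tperm m l) yI xI yspread xspread.
  by move=> t; rewrite (yP t).1 (xg t).1 tpermL.
exists (g \o b \o g).
  by apply: (M_mul) => //; apply: (M_mul) => //; exact: M_permuting bpi.
exists l, (e \o h); split=> [|a]; first exact: inj_comp.
have /choice[k kP] : forall v, exists i : {i | I i}, F (sval i) v.
  by move=> v; have [i Ii Fv] : (\bigcup_(i in I) F i) v; [rewrite FT|exists (exist _ i Ii)].
have /choice[q qP] : forall i : {i | I i}, exists q : Omega -> Omega,
    (forall v, F (sval i) v -> fiber l g (y (a, i)) (q v)) /\
    (forall v v', F (sval i) v -> F (sval i) v' -> q v = q v' -> v = v').
  by move=> i; apply/(card_leEx w0); exact: (yP (a, i)).2.
exists (fun v => q (k v) v); split=> [v v' vv|v].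
  have [_ g1] := (qP _).1 _ (kP v); have [_ g2] := (qP _).1 _ (kP v').
  have kk : k v = k v'.
    by have /yI[] : y (a, k v) = y (a, k v') by rewrite -g1 -g2 vv.
  by apply: ((qP (k v)).2 _ _ (kP v)); [rewrite kk; exact: kP|rewrite vv kk].
have [ql g1] := (qP _).1 _ (kP v); split=> //.
by rewrite /= g1 byx (xg _).2.
Qed.

End Fibers.

(** * The equivalence *)

Lemma partition_blocks (Omega : Type) n (P : 'I_n -> set Omega) :
  partition [set: 'I_n] P [set: Omega] -> exists part, P = block part.
Proof.
move=> [Pcov Ptriv _].
have /choice[part partP] : forall w, exists i, P i w.
  by move=> w; have [i _ Pi] : cover [set: 'I_n] P w; [rewrite Pcov|exists i].
exists part; apply: functional_extensionality_dep => i.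
apply/seteqP; split=> w; last by move=> <-.
by move=> Piw; apply: Ptriv => //; exists w.
Qed.

Lemma permuting_Stab (Omega : Type) n (part : Omega -> 'I_n) pi b :
  permuting part pi b -> Stab (block part) b.
Proof.
move=> bpi; have [bbij bpart] := bpi; split=> // i; exists (pi i).
have [b' [_ b'part] bK] := permuting_inv bpi.
apply/seteqP; split=> [_ [w wi <-]|w wi]; first by rewrite /block /= bpart wi.
have b'K : cancel b' b by case: bbij => c bc cb v; rewrite -(cb v) bK.
by exists (b' w) => //; rewrite /block /= b'part wi permK.
Qed.

Lemma Stab_AStab (Omega : Type) (Omega_infinite : infinite_set [set: Omega]) n
  (P : 'I_n -> set Omega) : Stab P `<=` AStab P.
Proof.
move=> f [fsym fP]; split=> // i; have [j ij] := fP i; exists j.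
rewrite ij setDv /disjoint_sum !image_set0 setU0; split; first exact: card_ge0.
by move=> /card_le0P T0; apply: Omega_infinite; rewrite T0; exact: finite_set0.
Qed.

Lemma disjoint_sum_small (Omega : Type) (A B : set Omega) :
  disjoint_sum A B #< [set: Omega] ->
  ~ ([set: Omega] #<= A) /\ ~ ([set: Omega] #<= B).
Proof.
move=> [_ N]; split=> L; apply: N; apply: (card_le_trans L).
  apply: (card_le_trans (_ : A #<= (inl @` A : set (Omega + Omega)))).
    by rewrite (card_le_eqr (inj_card_eq _))// => x y _ _ [].
  exact/subset_card_le/subsetUl.
apply: (card_le_trans (_ : B #<= (inr @` B : set (Omega + Omega)))).
  by rewrite (card_le_eqr (inj_card_eq _))// => x y _ _ [].
exact/subset_card_le/subsetUr.
Qed.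

Lemma bijectiveP (Omega : Type) (u : Omega -> Omega) :
  bijective u <-> injective u /\ forall a, exists v, u v = a.
Proof.
split=> [ub|[uI /choice[v vK]]].
  split; first exact: bij_inj.
  by case: ub => v _ vK a; exists (v a).
by exists v => // a; apply: uI.
Qed.

(** Relations that are permutations or not total are closed under passing to a
subrelation of a product: a total subrelation of a permutation is equal to it. *)
Lemma SymRel_comp n (r1 r2 r3 : set ('I_n * 'I_n)) :
  (forall i k, r3 (i, k) -> exists2 j, r1 (i, j) & r2 (j, k)) ->
  SymRel r1 \/ ~ total_relation r1 -> SymRel r2 \/ ~ total_relation r2 ->
  SymRel r3 \/ ~ total_relation r3.
Proof.
move=> r3c C1 C2.
have [tot3|] := pselect (total_relation r3); [left|by right].
case: C1 => [[s _ sr1]|[]]; last first.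
  by move=> i; have [k /r3c[j r1ij _]] := tot3 i; exists j.
have r1s i j : r1 (i, j) -> s i = j by rewrite -sr1.
case: C2 => [[t _ tr2]|[]]; last first.
  move=> j; have [k /r3c[j' /r1s <-]] := tot3 ((s^-1)%g j).
  by rewrite permKV; exists k.
have r2t j k : r2 (j, k) -> t j = k by rewrite -tr2.
exists (s * t)%g => //; apply/seteqP; split=> -[i k]; rewrite /relation_of_perm /= permM.
  move=> <-; have [k' r3k'] := tot3 i.
  by have [j /r1s -> /r2t ->] := r3c _ _ r3k'.
by move=> /r3c[j /r1s <- /r2t].
Qed.

Section Characterization.
Variables (Omega : Type) (n : nat) (part : Omega -> 'I_n).
Hypothesis Omega_infinite : infinite_set [set: Omega].
Hypothesis block_large : forall i, large (block part i).

Let P := block part.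

Lemma rho_total u : injective u -> total_relation (rho P u).
Proof.
move=> uI i; have [x [xI xi]] := block_large i.
have [j [psi [psiI psij]]] := infinite_pigeonhole (fun t => part (u (x t))) Omega_infinite.
exists j; apply/(crosses_rho Omega_infinite _ _ _ erefl).
exists (x \o psi); split=> [t|t|]; [exact: xi|exact: psij|].
by do 2!(apply: inj_comp => //).
Qed.

Lemma rho_inv_total u t : cancel t u -> total_relation (rho P u)^-1%relation.
Proof.
move=> tu j; have [x [xI xj]] := block_large j.
have [i [psi [psiI psii]]] := infinite_pigeonhole (fun a => part (t (x a))) Omega_infinite.
exists i; apply/(crosses_rho Omega_infinite _ _ _ erefl).
exists (t \o x \o psi); split=> [a|a|a b]; first exact: psii.
  by rewrite /= tu; exact: xj.
by rewrite /= !tu => /xI/psiI.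
Qed.

Lemma rho_comp u v i k : rho P (v \o u) (i, k) ->
  exists2 j, rho P u (i, j) & rho P v (j, k).
Proof.
move=> /(crosses_rho Omega_infinite _ _ _ erefl)/(crosses_comp Omega_infinite)[j ? ?].
by exists j; apply/(crosses_rho Omega_infinite _ _ _ erefl).
Qed.

(** Used with M generated by the stabiliser, f and g; the proof assembles the steps above
from one section t of g. *)
Lemma sufficiency (M : set (Omega -> Omega)) f g : mul_closed M ->
  Stab P `<=` M -> M f -> M g -> generating_condition P f g -> M = setT.
Proof.
move=> M_mul MStab Mf Mg [fI fdef gsurj gk gr].
have M_permuting pi b : permuting part pi b -> M b.
  by move=> /permuting_Stab; exact: MStab.
have /choice[t tg] : forall a, exists v, g v = a.
  by move=> a; have [v _ va] := gsurj a I; exists v.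
have [F [MF FI Fspread]] : exists F, [/\ M F, injective F & spread part F].
  apply: (spread_injection Omega_infinite block_large M_mul M_permuting Mf fI).
  exact/(card_eq_large Omega_infinite).
have [G0 MG0 [l G0l]] : exists2 h, M h & exists l, large_fibers part h l.
  case: gk => [[_ /(card_eq_large Omega_infinite)]|[sing gk]].
    by move=> /(regular_large_fibers part Omega_infinite); exists g.
  apply: (singular_large_fibers Omega_infinite block_large M_mul M_permuting Mg sing).
  by move=> N Ns; exact/(card_eq_large Omega_infinite)/gk.
have tlarge : large (~` range t).
  have [e [eI eP]] : exists e : Omega -> Omega, injective e /\
      forall a, exists v, v <> t (e a) /\ g v = e a.
    have [b [b' bb']] := infinite_two_points Omega_infinite.
    have two a (N : set Omega) : N b -> N b' -> N #<= g @^-1` [set a] ->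
        exists v, v <> t a /\ g v = a.
      move=> Nb Nb' /(card_leEx b)[x [xg xI]].
      have [xb|] := pselect (x b = t a); last by exists (x b); split=> //; exact: xg.
      exists (x b'); split; last exact: xg.
      by rewrite -xb => /xI; move=> /(_ Nb' Nb) /esym.
    case: gk => [[_ /(card_eq_large Omega_infinite)[e [eI eP]]]|[_ gk]].
      by exists e; split=> // a; exact: two (eP a).
    have /(card_eq_large Omega_infinite)[e [eI eP]] :
        contraction_set g [set b; b'] #= [set: Omega].
      apply: gk; split; first exact: card_leT.
      by move=> /card_le_finite H; apply: Omega_infinite; apply: H; exact: finite_set2.
    by exists e; split=> // a; apply: two (eP a); [left|right].
  have /choice[v vP] := eP.
  exists v; split=> [a a' /(congr1 g)|a]; first by rewrite !(vP _).2 => /eI.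
  move=> [a' _ ta']; case: (vP a) => + gv; rewrite -gv -ta' tg; exact.
have [G [s [MG sG sspread]]] :=
  spread_section Omega_infinite block_large M_mul M_permuting Mg tg tlarge.
have ftot := rho_total fI; have gtot := rho_inv_total tg.
have [c [u Mu uc]] : exists c, exists2 u, M u & forall i, crosses part u i c.
  have col h := exists_full_column Omega_infinite block_large M_mul M_permuting
    (P := P) (u := h) erefl.
  by case: gr => [[Nf _]|[Nf _]|[Ng gt]]; [exact: col ftot _|exact: col ftot _|exact: col gt _].
have [k [r Mr rk]] : exists l, exists2 u, M u & forall j, crosses part u l j.
  have row h := exists_full_row Omega_infinite block_large M_mul M_permuting
    (P := P) (u := h) erefl.
  by case: gr => [[_ Ng]|[Nf ft]|[Ng _]]; [exact: row gtot _|exact: row ft _|exact: row gtot _].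
have [w [z [Mw zw zk zspread]]] :=
  section_into_block Omega_infinite block_large M_mul M_permuting Mr rk MG sG sspread.
have [H MH Hfull] := full_fibers Omega_infinite block_large M_mul M_permuting
  Mu uc MG0 G0l Mw zw zk zspread.
exact: (all_maps Omega_infinite block_large M_mul M_permuting MF FI Fspread MH Hfull).
Qed.

(** Up to a set that is not large, f maps block i onto block s i, so that s i is the only
index related to i, and s is injective. *)
Lemma AStab_SymRel f : AStab P f -> SymRel (rho P f).
Proof.
move=> [fbij /choice[s sP]].
have fI : injective f by exact: bij_inj.
have small1 i : ~ large (f @` P i `\` P (s i)).
  by have [+ _] := disjoint_sum_small (sP i); rewrite card_ge_large.
have small2 i : ~ large (P (s i) `\` f @` P i).
  by have [_ +] := disjoint_sum_small (sP i); rewrite card_ge_large.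
have rs i j : rho P f (i, j) -> j = s i.
  rewrite /rho /= (card_eq_large Omega_infinite) => L; apply: contrapT => js.
  apply: (small1 i); apply: sub_large L => w [fw wj]; split=> // ws.
  by apply: js; rewrite -wj -ws.
have rs' i : rho P f (i, s i).
  rewrite /rho /= (card_eq_large Omega_infinite).
  have /(large_setU Omega_infinite)[//|/small1//] :
      large (f @` P i `&` P (s i) `|` f @` P i `\` P (s i)).
  have [x [xI xi]] := block_large i.
  exists (f \o x); split=> [|t]; first exact: inj_comp.
  have fx : (f @` P i) (f (x t)) by exists (x t) => //; exact: xi.
  by have [|] := pselect (P (s i) (f (x t))); [left|right].
have sI : injective s.
  move=> i i' ii'; apply: contrapT => Nii'; apply: (small2 i').
  have := rs' i; rewrite /rho /= (card_eq_large Omega_infinite) ii'.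
  apply: sub_large => w [[v vi vw] ws]; split=> // -[v' vi' v'w].
  apply: Nii'; have vv : v = v' by apply: fI; rewrite vw.
  by rewrite -vi -vi' vv.
exists (perm sI) => //; apply/seteqP; split=> -[i j]; rewrite /relation_of_perm /= permE.
  by move=> <-; exact: rs'.
by move=> /rs.
Qed.

(** On each block h is a left inverse of an embedding of Omega into that block. *)
Lemma exists_full_rho : exists h, forall i j, rho P h (i, j).
Proof.
have /choice[phi phiP] := block_large.
have /choice[h hP] : forall v, exists w, forall u, phi (part v) u = v -> w = u.
  move=> v; have [[u uv]|N] := pselect (exists u, phi (part v) u = v); last first.
    by exists v => u uv; case: N; exists u.
  by exists u => u' u'v; apply: (phiP (part v)).1; rewrite uv.
have hphi i w : h (phi i w) = w by apply: hP; rewrite (phiP i).2.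
exists h => i j; apply/(crosses_rho Omega_infinite _ _ _ erefl).
exists (phi i \o phi j); split=> [t|t|t s]; first exact: (phiP i).2.
  by rewrite /= hphi; exact: (phiP j).2.
by rewrite /= !hphi => /(phiP j).1.
Qed.

(** The first projection of Omega times Omega, transported to Omega. *)
Lemma exists_full_contraction : exists h : Omega -> Omega,
  forall a, large (h @^-1` [set a]).
Proof.
have [p pI] := infinite_square Omega_infinite.
have /choice[h hP] : forall v, exists w, forall xy, p xy = v -> w = xy.1.
  move=> v; have [[xy xyv]|N] := pselect (exists xy, p xy = v); last first.
    by exists v => xy xyv; case: N; exists xy.
  by exists xy.1 => xy'; rewrite -xyv => /pI ->.
exists h => a; exists (fun b => p (a, b)); split=> [b b' /pI[]//|b].
exact: (hP _ (a, b)).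
Qed.

Lemma exists_nonsurjective_injection : exists h : Omega -> Omega,
  injective h /\ large (~` range h).
Proof.
have [h [h' [hI h'I hh']]] := infinite_moieties Omega_infinite.
exists h; split=> //; exists h'; split=> // t [s _]; exact: hh'.
Qed.

Lemma injective_contraction (u : Omega -> Omega) (N : set Omega) b b' :
  injective u -> N b -> N b' -> b <> b' -> contraction_set u N = set0.
Proof.
move=> uI Nb Nb' bb'; apply/seteqP; split=> // a /(card_leEx b)[x [xu xI]].
by apply: bb'; apply: xI => //; apply: uI; rewrite (xu b Nb) (xu b' Nb').
Qed.

(** The general form of the closure arguments on fibres: a large fibre of a product
arises from a large fibre of one of the factors. *)
Lemma contraction_comp (u v : Omega -> Omega) (N N1 N2 : set Omega) :
  (forall a, N #<= (v \o u) @^-1` [set a] ->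
    N2 #<= v @^-1` [set a] \/ exists2 i, v i = a & N1 #<= u @^-1` [set i]) ->
  large (contraction_set (v \o u) N) ->
  large (contraction_set u N1) \/ large (contraction_set v N2).
Proof.
move=> H L.
have /(large_setU Omega_infinite)[] :
    large (contraction_set v N2 `|` v @` contraction_set u N1).
- apply: sub_large L => a /H[|[i ia Ni]]; [by left|by right; exists i].
- by right.
- by move=> /large_preimage_of_image; left.
Qed.

Hypothesis n_gt1 : (1 < n)%N.

Section Necessity.
Variables f g : Omega -> Omega.
Hypothesis gen : generated (AStab P `|` [set f; g]) = [set: Omega -> Omega].

Lemma proper_subsemigroup (V : set (Omega -> Omega)) : mul_closed V ->
  AStab P `<=` V -> (exists h, ~ V h) -> ~ V f \/ ~ V g.
Proof.
move=> Vmul VA [h Nh]; have [Vf|] := pselect (V f); [right|by left].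
move=> Vg; apply: Nh.
have : [set: Omega -> Omega] `<=` V.
  rewrite -gen; apply: smallest_sub => // u [/VA//|[->|->]//].
by apply.
Qed.

Lemma injective_generator :
  (injective f /\ ~ bijective f) \/ (injective g /\ ~ bijective g).
Proof.
have [|||/not_orP[? /contrapT ?]|/not_orP[? /contrapT ?]] :=
  @proper_subsemigroup [set u | bijective u \/ ~ injective u]; last 2 first.
- by left.
- by right.
- move=> u v [ub|uN] [vb|vN]; last 2 first.
  + by right=> vuI; apply: uN => x y xy; apply: vuI; rewrite /= xy.
  + by right=> vuI; apply: uN => x y xy; apply: vuI; rewrite /= xy.
  + by left; exact: bij_comp.
  + right=> vuI; apply: vN => x y; have [u' uK u'K] := ub.
    rewrite -(u'K x) -(u'K y) => /vuI xy; by rewrite xy.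
- by move=> u [ub _]; left.
have [h' [hI [phi [_ hN]]]] := exists_nonsurjective_injection.
exists h' => -[/bijectiveP[_ hS]|//].
have [x0 _] := infinite_inhabited Omega_infinite.
by apply: (hN x0); have [v vx] := hS (phi x0); exists v.
Qed.

Lemma surjective_generator :
  ((forall a, exists v, f v = a) /\ ~ bijective f) \/
  ((forall a, exists v, g v = a) /\ ~ bijective g).
Proof.
have [|||/not_orP[? /contrapT ?]|/not_orP[? /contrapT ?]] :=
  @proper_subsemigroup [set u | bijective u \/ ~ (forall a, exists v, u v = a)]; last 2 first.
- by left.
- by right.
- move=> u v [ub|uN] [vb|vN].
  + by left; exact: bij_comp.
  + by right=> vuS; apply: vN => a; have [w wa] := vuS a; exists (u w).
  + right=> vuS; apply: uN => a; have [w /(bij_inj vb)] := vuS (v a); by exists w.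
  + by right=> vuS; apply: vN => a; have [w wa] := vuS a; exists (u w).
- by move=> u [ub _]; left.
have [q qP] := exists_full_contraction; exists q => -[/bijectiveP[qI _]|[]].
  have [x0 _] := infinite_inhabited Omega_infinite.
  have [phi [phiI phiq]] := qP x0.
  have /(_ _ _)/phiI : forall x y, phi x = phi y.
    by move=> x y; apply: qI; rewrite (phiq x) (phiq y).
  move=> xy; apply: Omega_infinite.
  suff -> : [set: Omega] = [set x0] by exact: finite_set1.
  by apply/seteqP; split=> // x _; exact: xy.
move=> a; have [phi [_ phiq]] := qP a; exists (phi a); exact: phiq.
Qed.

Hypothesis f_inj : injective f.
Hypothesis g_surj : forall a, exists v, g v = a.

(** The points missed by a product are missed by its last factor or are images of points
missed by the first, so maps whose defect is not large form a semigroup. *)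
Lemma large_defect : large (~` range f).
Proof.
have [|||/contrapT//|/contrapT] :=
  @proper_subsemigroup [set u | ~ large (~` range u)].
- move=> u v Nu Nv L.
  have /(large_setU Omega_infinite)[//|/large_preimage_of_image//] :
      large (~` range v `|` v @` (~` range u)).
  apply: sub_large L => w Nw; have [[x _ xw]|] := pselect (range v w); [right|by left].
  exists x => // -[y _ yx]; apply: Nw; exists y => //=; by rewrite yx.
- move=> u [/bijectiveP[_ uS] _] [phi [_ phiN]].
  have [x0 _] := infinite_inhabited Omega_infinite.
  by apply: (phiN x0); have [v vx] := uS (phi x0); exists v.
- have [h' [_ hN]] := exists_nonsurjective_injection.
  by exists h'; apply.
move=> [phi [_ phiN]]; have [x0 _] := infinite_inhabited Omega_infinite.
by exfalso; apply: (phiN x0); have [v vx] := g_surj (phi x0); exists v.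
Qed.

(** By regularity, a large fibre of u v lies over a large fibre of v or is a union in
which the fibre of u over some point is large. *)
Lemma regular_contraction : regular_card Omega -> large (contraction_set g [set: Omega]).
Proof.
move=> reg; have [b [b' bb']] := infinite_two_points Omega_infinite.
have injN u : injective u -> ~ large (contraction_set u [set: Omega]).
  by move=> uI; rewrite (injective_contraction uI (b := b) (b' := b'))//;
    exact: not_large0 Omega_infinite.
have [|||/contrapT|/contrapT//] :=
  @proper_subsemigroup [set u | ~ large (contraction_set u [set: Omega])].
- move=> u v Nu Nv /(contraction_comp (N1 := setT) (N2 := setT))[]// a.
  move=> /(card_ge_large Omega_infinite)[phi [phiI phia]].
  have [|Ns] := pselect ([set: Omega] #<= v @^-1` [set a]); [by left|right].
  apply: contrapT => NN.
  apply: (reg (v @^-1` [set a]) (fun i => phi @^-1` (u @^-1` [set i]))).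
  + by split=> //; exact: card_leT.
  + move=> i ia; apply/(card_lt_large Omega_infinite) => -[psi [psiI psii]].
    apply: NN; exists i => //; apply/(card_ge_large Omega_infinite).
    by exists (phi \o psi); split=> //; exact: inj_comp.
  + apply/seteqP; split=> // w _; exists (u (phi w)) => //; exact: phia.
- by move=> u [/bij_inj uI _]; exact: injN.
- have [q qP] := exists_full_contraction; exists q; apply; exists id; split=> // a.
  exact/(card_ge_large Omega_infinite).
by move=> /(injN _ f_inj).
Qed.

(** If u has few fibres of size at least N1 and v has few of size at least N2, then u v
has few fibres of any size exceeding N1 times N2, and [singular_limit] provides such
a size below |Omega|. *)
Lemma singular_contraction : ~ regular_card Omega ->
  forall N : set Omega, N #< [set: Omega] -> large (contraction_set g N).
Proof.
move=> Nreg N0 N0s; apply: contrapT => N0g.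
have [b [b' bb']] := infinite_two_points Omega_infinite.
pose V := [set u : Omega -> Omega |
  exists2 N : set Omega, N #< [set: Omega] & ~ large (contraction_set u N)].
have injV u : injective u -> V u.
  move=> uI; exists [set b; b'].
    split; first exact: card_leT.
    by move=> /card_le_finite H; apply: Omega_infinite; apply: H; exact: finite_set2.
  by rewrite (injective_contraction uI (b := b) (b' := b'))//;
    [exact: not_large0 Omega_infinite|left|right].
have [|||//|] := @proper_subsemigroup V.
- move=> u v [N1 N1s N1u] [N2 N2s N2v].
  have [N [Ns NN]] := singular_limit Omega_infinite Nreg N1s.2 N2s.2.
  exists N => // /(contraction_comp (N1 := N1) (N2 := N2))[]// a Na.
  have [|vN2] := card_le_total N2 (v @^-1` [set a]); [by left|right].
  apply: contrapT => NN1; apply: NN; apply: (card_le_trans Na).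
  have /(card_leEx b)[q [qN2 qI]] := vN2.
  have /choice[r rP] : forall i, exists r : Omega -> Omega, v i = a ->
      (forall x, u x = i -> N1 (r x)) /\ (forall x y, u x = i -> u y = i -> r x = r y -> x = y).
    move=> i; have [ia|] := pselect (v i = a); last by exists id.
    have [N1u'|/(card_leEx b)[r rP]] := card_le_total N1 (u @^-1` [set i]).
      by case: NN1; exists i.
    by exists r.
  apply/(card_leEx (b, b)); exists (fun x => (r (u x) x, q (u x))); split=> [x xa|x y xa ya].
    by split; [exact: (rP _ xa).1|exact: qN2].
  move=> [+ /(qI _ _ xa ya) uxy]; rewrite -uxy.
  exact: (rP _ xa).2.
- by move=> u [/bij_inj uI _]; exact: injV.
- have [q qP] := exists_full_contraction; exists q => -[N Ns]; apply.
  exists id; split=> // a; apply: card_le_trans (card_leT _) _.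
  exact/(card_ge_large Omega_infinite).
- by case; exact: injV.
by case; exists N0.
Qed.

(** If all three cases failed, f and g would both lie in the semigroup attached to total
relations, when rho(f) is a permutation, or in the one attached to total inverses,
when rho(g) is. *)
Lemma rho_condition :
  [\/ ~ SymRel (rho P f) /\ ~ SymRel (rho P g),
      ~ SymRel (rho P f) /\ total_relation (rho P f)^-1%relation |
      ~ SymRel (rho P g) /\ total_relation (rho P g)].
Proof.
have [t gt] : exists t, cancel t g.
  by have /choice[t tg] := g_surj; exists t.
have [h hP] := exists_full_rho.
have Nh : ~ SymRel (rho P h).
  move=> [s _ sh].
  have s_eq j : s (Ordinal (ltnW n_gt1)) = j.
    by have := hP (Ordinal (ltnW n_gt1)) j; rewrite -sh.
  by have := s_eq (Ordinal (ltnW n_gt1)); rewrite (s_eq (Ordinal n_gt1)) => /(congr1 val).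
have F1 : ~ (SymRel (rho P f) \/ ~ total_relation (rho P f)) \/
          ~ (SymRel (rho P g) \/ ~ total_relation (rho P g)).
  apply: (@proper_subsemigroup [set u | SymRel (rho P u) \/ ~ total_relation (rho P u)]).
  - by move=> u v; apply: SymRel_comp => i k; exact: rho_comp.
  - by move=> u /AStab_SymRel; left.
  - by exists h => -[//|]; apply=> i; exists i.
have F2 : ~ (SymRel (rho P f) \/ ~ total_relation (rho P f)^-1%relation) \/
          ~ (SymRel (rho P g) \/ ~ total_relation (rho P g)^-1%relation).
  apply: (@proper_subsemigroup
    [set u | SymRel (rho P u) \/ ~ total_relation (rho P u)^-1%relation]).
  - move=> u v; rewrite /= -(SymRel_inv (rho P u)) -(SymRel_inv (rho P v)).
    rewrite -(SymRel_inv (rho P (v \o u))) => Cu Cv.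
    apply: SymRel_comp Cv Cu => k i /= /rho_comp[j ? ?]; by exists j.
  - by move=> u /AStab_SymRel; left.
  - by exists h => -[//|]; apply=> i; exists i; exact: hP.
have ft := rho_total f_inj; have gt' := rho_inv_total gt.
have [fs|Nfs] := pselect (SymRel (rho P f)).
  case: F1 => [[]|/not_orP[Ngs /contrapT]]; first by left.
  by move=> gtot; apply: Or33.
have [gs|Ngs] := pselect (SymRel (rho P g)); last exact: Or31.
case: F2 => [/not_orP[_ /contrapT finv]|[]]; [exact: Or32|by left].
Qed.

End Necessity.

Lemma necessity f g : generated (AStab P `|` [set f; g]) = [set: Omega -> Omega] ->
  generating_condition P f g \/ generating_condition P g f.
Proof.
have cond u v : generated (AStab P `|` [set u; v]) = [set: Omega -> Omega] ->
    injective u -> (forall a, exists x, v x = a) -> generating_condition P u v.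
  move=> gen uI vS; split=> //.
  - exact/(card_eq_large Omega_infinite)/(large_defect gen).
  - by move=> a _; have [x xa] := vS a; exists x.
  - have [reg|Nreg] := pselect (regular_card Omega); [left|right]; split=> //.
      exact/(card_eq_large Omega_infinite)/(regular_contraction gen).
    move=> N Ns; apply/(card_eq_large Omega_infinite).
    exact: (singular_contraction gen).
  - exact: rho_condition gen uI vS.
move=> gen.
have genC : generated (AStab P `|` [set g; f]) = [set: Omega -> Omega].
  by rewrite -gen; congr (generated (_ `|` _)); exact: setUC.
case: (injective_generator gen) (surjective_generator gen) => -[uI Nu] [[vS Nv]|[vS Nv]].
- by case: Nu; apply/bijectiveP.
- by left; exact: cond.
- by right; exact: cond.
- by case: Nu; apply/bijectiveP.
Qed.

End Characterization.

Theorem corollary4p5 (Omega : Type) (Omega_infinite : infinite_set [set: Omega])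
    (n : nat) (P : 'I_n -> set Omega) (P_partition : finite_partition P)
    (f g : Omega -> Omega) :
  [<-> generated (Stab P `|` [set f; g]) = [set: Omega -> Omega];
       generated (AStab P `|` [set f; g]) = [set: Omega -> Omega];
       generating_condition P f g \/ generating_condition P g f].
Proof.
have [n_gt1 /partition_blocks[part PE] P_card] := P_partition; rewrite {}PE in P_card *.
have block_large i : large (block part i) by exact/(card_eq_large Omega_infinite).
have mulS (S : set (Omega -> Omega)) : mul_closed (generated S).
  by move=> u v Su Sv V [Vmul SV]; apply: (Vmul); [apply: Su|apply: Sv]; split.
tfae.
- move=> gen; apply/seteqP; split=> // u _.
  have : generated (Stab (block part) `|` [set f; g]) u by rewrite gen.
  apply: sub_smallest2r; first exact: mulS.
  by apply: setSU; exact: Stab_AStab.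
- exact: necessity.
- move=> cond; have gen : Stab (block part) `|` [set f; g] `<=`
      generated (Stab (block part) `|` [set f; g]) by exact: sub_gen_smallest.
  case: cond => cond; apply: (sufficiency Omega_infinite block_large (mulS _) _ _ _ cond).
  + by move=> u ?; apply: gen; left.
  + by apply: gen; right; left.
  + by apply: gen; right; right.
  + by move=> u ?; apply: gen; left.
  + by apply: gen; right; right.
  + by apply: gen; right; left.
Qed.
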